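(* Let $(K,v)$ be a perfect valued field of rank one with $\operatorname{char}K=p$ an odd prime, and let $(F|K,w)$ be an immediate extension of valued function fields of transcendence degree one. Assume that $K=K^r$. Let $X\in F\setminus K$ be a separating transcendental element of $F|K$, and assume that the extension $(K(X)|K,w)$ is of Type II. Then $(F|K,w)$ is henselian rational.
   Context: $(F|K,w)$ is a finitely generated field extension of transcendence degree one with a valuation $w$ on $F$ extending $v$; immediate means $wF=vK$ and $Fw=Kv$. A separating transcendental element is an $X\in F$ transcendental over $K$ with $F|K(X)$ finite separable. Fix an extension of $w$ to an algebraic closure $\overline F$, again denoted $w$; its restriction to $\overline K\subset\overline F$ is denoted $v$. Henselizations $E^h$ are taken inside $\overline F$ with respect to this extension. Absolute ramification field: $G^r:=\{\sigma\in\mathrm{Gal}(\overline K|K)\mid v(\sigma a-a)>va\ \text{for all } a\in\overline K\setminus\{0\}\}$ and $K^r$ is the fixed field of $G^r$ in $\overline K$. Henselian rational: $(F|K,w)$ is henselian rational if there is $Y\in F^h$ transcendental over $K$ with $F^h=K(Y)^h$. Type II: let $(\widehat K,\widehat v)$ be a completion of $(K,v)$; there is a common extension $\widehat w$ of $w$ and $\widehat v$ to $\overline{\widehat K}(X)$, and $(\widehat K(X)|\widehat K,\widehat w)$ is the induced extension. The immediate extension $(K(X)|K,w)$ is of Type II if it satisfies the following (known to be equivalent) conditions: (C1) $(\widehat K(X)|\widehat K,\widehat w)$ is not immediate; (C2) $(\widehat K(X)|\widehat K,\widehat w)$ is valuation transcendental, i.e. $\dim_{\mathbb Q}\bigl(\mathbb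 Q\otimes_{\mathbb Z}(\widehat w\widehat K(X)/\widehat v\widehat K)\bigr)+\operatorname{trdeg}[\widehat K(X)\widehat w:\widehat K\widehat v]=1$; (C3) there is a Cauchy sequence in $(\overline K,v)$ corresponding to $(\overline K(X)|\overline K,w)$, i.e. a pseudo-convergent sequence $\{z_\nu\}_{\nu<\lambda}$ in $\overline K$ without limit in $\overline K$, with $X$ as a limit ($w(X-z_\nu)=v(z_\nu-z_{\nu+1})$ for all $\nu$), and with $\{v(z_\nu-z_{\nu+1})\}$ cofinal in $v\overline K$. *)

(* Defs.v *)
From HB Require Import structures.
From mathcomp Require Import all_boot all_order all_algebra separable.
From mathcomp Require Import boolp classical_sets functions.

Set Implicit Arguments.
Unset Strict Implicit.
Unset Printing Implicit Defensive.

Import Order.TTheory GRing.Theory Num.Theory.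

Local Open Scope classical_set_scope.
Local Open Scope ring_scope.

(* All fields live inside one algebraically closed field L (the algebraic
   closure of F), and all valuations are restrictions of one valuation w of L:
   a field is a set E of elements of L that is closed under the field
   operations, and (E, w) stands for E with the restriction of w. *)

Section Fields.
Context {L : fieldType}.
Implicit Types (E F K S : set L) (a x : L) (p q : {poly L}).

Definition subfield E : Prop := GRing.divring_closed (mem E).

Definition adjoin K S : set L := smallest subfield (K `|` S).

Definition algebraic_over E a : Prop :=
  exists p, [/\ p != 0, p \is a polyOver (mem E) & root p a].

Definition transcendental_over E a : Prop := ~ algebraic_over E a.

Definition alg_closure E : set L := [set a | algebraic_over E a].

Definition is_minpoly E a p : Prop :=
  [/\ p \is monic, p \is a polyOver (mem E), root p a
    & forall q, q != 0 -> q \is a polyOver (mem E) -> root q a ->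
        (size p <= size q)%N].

Definition separable_over E a : Prop :=
  exists2 p, is_minpoly E a p & separable_poly p.

(* F is spanned by finitely many of its elements as an E-vector space. *)
Definition finite_over E F : Prop :=
  exists s : seq L,
    [set` s] `<=` F /\
    forall y, F y -> exists2 c : 'I_(size s) -> L,
      forall i, E (c i) & y = \sum_i c i * s`_i.

(* Finitely generated extension of transcendence degree one; the second
   condition says that {t} is a transcendence basis of F|K. *)
Definition function_field1 K F : Prop :=
  [/\ K `<=` F,
      exists s : seq L, F = adjoin K [set` s]
    & exists t, [/\ F t, transcendental_over K t
                  & F `<=` alg_closure (adjoin K [set t])]].

Definition separating_element K F x : Prop :=
  [/\ F x, transcendental_over K x, finite_over (adjoin K [set x]) F
    & forall y, F y -> separable_over (adjoin K [set x]) y].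

(* The characteristic exponent of E is that of L, so for p \in [pchar L] this
   is E ^ p = E, and in characteristic 0 it is no condition. *)
Definition perfect E : Prop :=
  forall p : nat, p \in [pchar L] ->
    forall a, E a -> exists2 b, E b & b ^+ p = a.

(* s represents an element of Gal(alg_closure E | E); its values outside
   alg_closure E are irrelevant. *)
Definition galois_aut E (s : L -> L) : Prop :=
  [/\ set_bij (alg_closure E) (alg_closure E) s,
      forall a b, alg_closure E a -> alg_closure E b ->
        s (a + b) = s a + s b /\ s (a * b) = s a * s b
    & forall a, E a -> s a = a].

End Fields.

Definition ordered_group (G : porderZmodType) : Prop :=
  total (<=%R : rel G) /\ (forall g h k : G, g <= h -> g + k <= h + k).

Section ConvexSubgroups.
Context {G : porderZmodType}.
Implicit Types A H : set G.

Definition convex_subgroup A H : Prop :=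
  [/\ H `<=` A, GRing.zmod_closed (mem H)
    & forall g h, A g -> H h -> 0 <= g -> g <= h -> H g].

Definition rank_one A : Prop :=
  A <> [set 0] /\ (forall H, convex_subgroup A H -> H = [set 0] \/ H = A).

End ConvexSubgroups.

(* Values lie in option G, where None is the value "infinity" of 0. *)
Section Values.
Context {G : porderZmodType}.
Implicit Types a b : option G.

Definition vle a b : bool :=
  match a, b with
  | _, None => true
  | None, Some _ => false
  | Some g, Some h => g <= h
  end.

Definition vlt a b : bool := vle a b && (a != b).

Definition vadd a b : option G :=
  match a, b with
  | Some g, Some h => Some (g + h)
  | _, _ => None
  end.

End Values.

Section Valuations.
Context {L : fieldType} {G : porderZmodType}.
Implicit Types (w : L -> option G) (E F K : set L) (X a x : L).

Record valuation w : Prop := Valuation {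
  val_eqinf : forall x, w x = None <-> x = 0;
  valM : forall x y, w (x * y) = vadd (w x) (w y);
  valD : forall x y, vle (w x) (w y) -> vle (w x) (w (x + y)) }.

Definition value_group w E : set G :=
  [set g | exists2 x, E x & w x = Some g].

Definition valuation_ring w E : set L :=
  [set x | E x /\ vle (Some 0) (w x)].

Definition maximal_ideal w E : set L :=
  [set x | E x /\ vlt (Some 0) (w x)].

(* The residue of x is its coset modulo the maximal ideal of L; the residue
   field of E is thereby a subset of the residue field of L. *)
Definition residue w x : set L := [set y | maximal_ideal w setT (y - x)].

Definition residue_field w E : set (set L) :=
  [set residue w x | x in valuation_ring w E].

Definition immediate w K F : Prop :=
  [/\ K `<=` F, value_group w F = value_group w K
    & residue_field w F = residue_field w K].

(* A subfield satisfying Hensel's Lemma. *)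
Definition henselian w E : Prop :=
  subfield E /\
  forall (f : {poly L}) a,
    f \is monic -> f \is a polyOver (mem (valuation_ring w E)) ->
    valuation_ring w E a ->
    maximal_ideal w E f.[a] -> ~ maximal_ideal w E f^`().[a] ->
    exists b, [/\ valuation_ring w E b, root f b & maximal_ideal w E (b - a)].

(* For L algebraically closed, the intersection of all henselian subfields of
   L containing E is itself henselian: it is the henselization of (E, w) inside
   (L, w), i.e. the decomposition field of w over E. *)
Definition henselization w E : set L := smallest (henselian w) E.

Definition henselian_rational w K F : Prop :=
  exists Y, [/\ henselization w F Y, transcendental_over K Y
    & henselization w F = henselization w (adjoin K [set Y])].

Definition ramification_group w K : set (L -> L) :=
  [set s | galois_aut K s /\
     forall a, alg_closure K a -> a != 0 -> vlt (w a) (w (s a - a))].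

Definition ramification_field w K : set L :=
  [set a | alg_closure K a /\
     forall s, ramification_group w K s -> s a = a].

End Valuations.

Section PseudoConvergence.
Context {L : fieldType} {G : porderZmodType}.

(* Index sets {nu | nu < lambda} with lambda a limit ordinal: nonempty
   well-ordered sets without a greatest element. *)
Definition limit_order d (I : orderType d) : Prop :=
  [/\ well_founded (fun i j : I => (i < j)%O), exists i : I, True
    & forall i : I, exists j : I, (i < j)%O].

Definition is_succ d (I : orderType d) (i j : I) : Prop :=
  (i < j)%O /\ forall k : I, (i < k)%O -> (j <= k)%O.

Definition pseudo_convergent (w : L -> option G) d (I : orderType d)
    (z : I -> L) : Prop :=
  forall i j k : I, (i < j)%O -> (j < k)%O ->
    vlt (w (z j - z i)) (w (z k - z j)).

Definition pseudo_limit (w : L -> option G) d (I : orderType d)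
    (z : I -> L) (x : L) : Prop :=
  forall i j : I, is_succ i j -> w (x - z i) = w (z i - z j).

(* Type II for K(X)|K, in terms of a Cauchy sequence in the algebraic closure
   of K that corresponds to X. *)
Definition type_II (w : L -> option G) (K : set L) (X : L) : Prop :=
  exists (d : Order.disp_t) (I : orderType d) (z : I -> L),
    [/\ limit_order I,
        forall i, alg_closure K (z i),
        pseudo_convergent w z,
        (forall a, alg_closure K a -> ~ pseudo_limit w z a) /\
          pseudo_limit w z X
      & forall g, value_group w (alg_closure K) g ->
          exists i j, is_succ i j /\ vle (Some g) (w (z i - z j))].

End PseudoConvergence.

(* Main.v *)
(* Every element of F is a limit of elements of the algebraic closure of K, since X is
   one. The decisive step improves this: an element b of F is even a limit of elements
   of F^h that are algebraic over K. Take z algebraic over K and close to b; the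
   conjugates of z that are close to b are the roots of a polynomial h over F^h
   (a henselian field contains the polynomial of such a cluster of roots), hence over
   the algebraic closure of K in F^h. A trace argument in the style of Ax yields an
   element close to b in that closure, and no precision is lost because K is perfect:
   replacing z by z^q and taking q-th roots divides the loss by q = p^n.

   By Krasner's lemma, each generator b of F that is separable over K(X) is therefore in
   K(X, theta)^h for some theta in F^h algebraic over K. The theta are absorbed into the
   generator one at a time: K(theta, Y)^h = K(theta + c Y)^h as soon as c Y is smaller
   than the distances between the conjugates of theta. Starting with Y = X and running
   through a finite set of generators gives F^h = K(Y)^h. *)

Require Import Defs.
From HB Require Import structures.
From mathcomp Require Import all_boot all_order all_algebra separable.
From mathcomp Require Import boolp classical_sets functions.
From mathcomp Require Import perm mpoly ring.

Set Implicit Arguments.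
Unset Strict Implicit.
Unset Printing Implicit Defensive.

Import Order.TTheory GRing.Theory Num.Theory.

Local Open Scope classical_set_scope.
Local Open Scope ring_scope.

(** * Valuation rings and Newton's lemma *)

(* The maximal ideal of [O], provided that [O] is a valuation ring. *)
Definition max_ideal (L : fieldType) (O : {pred L}) : {pred L} :=
  [pred x | (x == 0) || (x^-1 \notin O)].

(** Hensel's lemma for the valuation ring [O ∩ E] of [E]. Since [O] is a valuation ring of the
    ambient field, residue conditions over different [E] are tested in the same ideal. *)
Definition hensel (L : fieldType) (O E : {pred L}) : Prop :=
  forall (f : {poly L}) a,
    f \is monic -> f \is a polyOver E -> f \is a polyOver O ->
    a \in E -> a \in O -> f.[a] \in max_ideal O ->
    f^`().[a] \notin max_ideal O ->
    exists2 b, b \in E & root f b /\ b - a \in max_ideal O.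

Section ValuationRing.
Context {L : fieldType} {O : subringClosed L}.
Hypothesis val_total : forall x, x \in O \/ x^-1 \in O.
Local Notation mm := (max_ideal O).

Lemma max_ideal0 : 0 \in mm.
Proof. by rewrite inE eqxx. Qed.

Lemma max_idealW x : x \in mm -> x \in O.
Proof.
rewrite inE => /orP[/eqP->|]; first exact: rpred0.
by case: (val_total x) => // ->.
Qed.

Lemma max_idealE x : x != 0 -> (x \in mm) = (x^-1 \notin O).
Proof. by rewrite inE => /negPf ->. Qed.

Lemma max_idealV x : (x^-1 \in mm) = (x == 0) || (x \notin O).
Proof. by rewrite inE invr_eq0 invrK. Qed.

Lemma max_ideal1 : 1 \notin mm.
Proof. by rewrite max_idealE ?oner_eq0 // invr1 rpred1. Qed.

Lemma unit_inv x : x \in O -> x \notin mm -> x^-1 \in O.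
Proof. by rewrite inE negb_or negbK => _ /andP[]. Qed.

Lemma max_idealMr x y : x \in mm -> y \in O -> x * y \in mm.
Proof.
have [->|x0] := eqVneq x 0; first by rewrite mul0r.
have [->|y0] := eqVneq y 0; first by rewrite mulr0 max_ideal0.
rewrite !max_idealE ?mulf_neq0 // => xO yO; apply: contra xO => h.
have -> : x^-1 = y * (x * y)^-1 by rewrite invfM mulrCA divff ?mulr1.
by rewrite rpredM.
Qed.

Lemma max_idealMl x y : x \in O -> y \in mm -> x * y \in mm.
Proof. by move=> *; rewrite mulrC max_idealMr. Qed.

Lemma max_idealN x : x \in mm -> - x \in mm.
Proof. by move=> h; rewrite -mulN1r max_idealMl // rpredN rpred1. Qed.

Lemma max_idealD x y : x \in mm -> y \in mm -> x + y \in mm.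
Proof.
suff H a b : a / b \in O -> a \in mm -> b \in mm -> a + b \in mm.
  move=> hx hy; case: (val_total (x / y)) => h; first exact: H h hx hy.
  by rewrite addrC; apply: H => //; rewrite -invf_div.
move=> ab ha hb; have [->|b0] := eqVneq b 0; first by rewrite addr0.
have -> : a + b = b * (a / b + 1) by rewrite mulrDr mulr1 mulrCA divff ?mulr1.
by rewrite max_idealMr // rpredD // rpred1.
Qed.

Lemma max_idealB x y : x \in mm -> y \in mm -> x - y \in mm.
Proof. by move=> hx hy; rewrite max_idealD ?max_idealN. Qed.

Lemma max_ideal_sum (I : Type) (r : seq I) (P : pred I) (F : I -> L) :
  (forall i, P i -> F i \in mm) -> \sum_(i <- r | P i) F i \in mm.
Proof. by move=> h; elim/big_ind: _ => // [|x y]; [exact: max_ideal0 | exact: max_idealD]. Qed.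

Lemma max_ideal_congr x y : x - y \in mm -> (x \in mm) = (y \in mm).
Proof.
move=> h; apply/idP/idP => k; last by rewrite -[x](subrK y) max_idealD.
by rewrite -[y](subKr x) max_idealB.
Qed.

Lemma invr_notin x : x \notin O -> x^-1 \in mm.
Proof. by rewrite max_idealV => ->; rewrite orbT. Qed.

(** Were [x] outside [O], then [x^-1] and hence [1 = x^n x^-n] would be in the maximal ideal. This
    turns an estimate for a [q]-th power into one for the root. *)
Lemma expr_in n x : (0 < n)%N -> x ^+ n \in O -> x \in O.
Proof.
case: n => // n _ h; apply/negPn/negP => /[dup] hx /invr_notin hv.
have x0 : x != 0 by apply: contraNneq hx => ->; rewrite rpred0.
have : x ^+ n.+1 * (x^-1) ^+ n.+1 \in mm.
  by rewrite [_^-1 ^+ _]exprS max_idealMl // max_idealMr // rpredX // max_idealW.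
by rewrite -exprMn divff // expr1n (negPf max_ideal1).
Qed.

Lemma max_ideal_horner (q : {poly L}) a :
  (forall i, q`_i \in mm) -> a \in O -> q.[a] \in mm.
Proof.
by move=> hq ha; rewrite horner_coef max_ideal_sum // => i _; rewrite max_idealMr ?rpredX.
Qed.

(** Each factor [1 - z X] reduces to [1] modulo the maximal ideal. *)
Lemma prod_linear_mod (r : seq L) (i : nat) : {in r, forall z, z \in mm} ->
  (('X - 1) * \prod_(z <- r) (1 - z *: 'X) - ('X - 1))`_i \in mm.
Proof.
elim: r i => [|z r IH] i h; first by rewrite big_nil mulr1 subrr coef0 max_ideal0.
rewrite big_cons mulrCA.
set q := _ * \prod_(_ <- _) _.
have hq j : (q - ('X - 1))`_j \in mm.
  by apply: IH => y yr; apply: h; rewrite inE yr orbT.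
have qO j : q`_j \in O.
  rewrite -[q](subrK ('X - 1)) coefD rpredD //; first exact: max_idealW.
  by rewrite coefB coefX coef1 rpredB // rpred_nat.
have -> : (1 - z *: 'X) * q - ('X - 1) = q - ('X - 1) - z *: ('X * q).
  by rewrite mulrBl mul1r -scalerAl addrAC.
rewrite coefB coefZ coefXM max_idealB // max_idealMr ?h ?inE ?eqxx //.
by case: ifP => _; rewrite ?rpred0.
Qed.

End ValuationRing.

Section Newton.
Context {L : fieldType} {O : subringClosed L} {E : divringClosed L}.
Hypothesis val_total : forall x, x \in O \/ x^-1 \in O.
Hypothesis henE : hensel O E.
Local Notation mm := (max_ideal O).

(* The linear term of [f] dominates: with [rho = f_0 / f_1], the reverse of
   [f(rho X) / f_0] is monic and congruent to [X^n (X + 1)], so Hensel's lemma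
   lifts its simple root [-1], whose inverse times [rho] is [a]. *)
Lemma newton_at0 a (r : seq L) :
    ('X - a%:P) * \prod_(z <- r) ('X - z%:P) \is a polyOver E ->
    {in r, forall z, z != 0 /\ a / z \in mm} -> a \in E.
Proof.
move=> fE hr; have [->|a0] := eqVneq a 0; first exact: rpred0.
set f := _ * _ in fE.
(* Here [f(aX) = C q], and [q] reduces to [X - 1] because every [a / z] is in the maximal ideal. As
   [a] is not yet known to be in [E], the argument later rescales by [rho] instead, which is in [E]
   and equals [a] up to a unit. *)
pose q : {poly L} := ('X - 1) * \prod_(z <- r) (1 - (a / z) *: 'X).
pose C := a * \prod_(z <- r) (- z).
have C0 : C != 0.
  rewrite mulf_neq0 // prodf_seq_neq0; apply/allP => z zr /=.
  by rewrite oppr_eq0; case: (hr z zr).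
have fq : f \Po (a *: 'X) = C *: q.
  rewrite /f /q /C rmorphM /= comp_polyB comp_polyX comp_polyC rmorph_prod /=.
  have -> : a *: 'X - a%:P = a *: ('X - 1).
    by rewrite scalerBr -[a%:P]mulr1 mul_polyC.
  rewrite -scalerAl -[RHS]scalerA; congr (_ *: _).
  rewrite scalerAr; congr (_ * _).
  elim: (r) hr => [|z s IH] hs; first by rewrite !big_nil scale1r.
  rewrite !big_cons -[RHS]scalerA scalerAr -IH; last first.
    by move=> y ys; apply: hs; rewrite inE ys orbT.
  rewrite scalerAl; congr (_ * _).
  have [z0 _] := hs z (mem_head _ _).
  rewrite comp_polyB comp_polyX comp_polyC scalerBr scalerA mulNr.
  rewrite [z * _]mulrC divfK // !scaleNr opprK addrC.
  by rewrite -[z%:P]mulr1 mul_polyC.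
have uq j : f`_j * a ^+ j = C * q`_j.
  rewrite -coefZ -fq.
  have -> : f \Po (a *: 'X) = \poly_(i < size f) (f`_i * a ^+ i).
    rewrite comp_polyE poly_def; apply: eq_bigr => i _.
    by rewrite exprZn scalerA.
  rewrite coef_poly; case: ltnP => // h.
  by rewrite nth_default ?mul0r.
have hq j : (q - ('X - 1))`_j \in mm.
  rewrite /q -(big_map (fun z => a / z) xpredT (fun e => 1 - e *: 'X)).
  by apply: prod_linear_mod => // _ /mapP[z zr ->]; case: (hr z zr).
have q0 : q`_0 = -1.
  rewrite -horner_coef0 /q hornerM hornerD hornerX hornerN hornerC add0r.
  rewrite horner_prod big1_seq ?mulr1 // => z _.
  by rewrite hornerD hornerN hornerZ hornerX mulr0 subr0 hornerC.
have q1 : q`_1 - 1 \in mm.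
  by have := hq 1%N; rewrite !coefB coefX coef1 /= subr0.
have q1O : q`_1 \in O by rewrite -[q`_1](subrK 1) rpredD ?rpred1 // max_idealW.
have q1n : q`_1 \notin mm by rewrite (max_ideal_congr val_total q1) max_ideal1.
have q10 : q`_1 != 0 by apply: contraNneq q1n => ->; rewrite max_ideal0.
have q1V := unit_inv q1O q1n.
have u0 : f`_0 = - C by have := uq 0%N; rewrite expr0 mulr1 q0 mulrN1.
have u1 : f`_1 * a = C * q`_1 by rewrite -uq expr1.
have u10 : f`_1 != 0.
  have : f`_1 * a != 0 by rewrite u1 mulf_neq0.
  by rewrite mulf_eq0 negb_or => /andP[].
pose rho := f`_0 / f`_1.
have rhoE : rho = - a / q`_1.
  have -> : rho = - C / (C * q`_1 / a) by rewrite -u1 mulfK // -u0.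
  by field; rewrite C0 q10 a0.
have rho0 : rho != 0 by rewrite rhoE mulf_neq0 ?oppr_eq0 ?invr_eq0.
pose n := size r.
have sf : size f = n.+2.
  rewrite /f size_mul ?polyXsubC_eq0 ?size_XsubC //; last first.
    by rewrite prodf_seq_neq0; apply/allP => z _; rewrite /= polyXsubC_eq0.
  by rewrite size_prod_XsubC.
have fmon : f \is monic by rewrite monicMl ?monicXsubC ?monic_prod_XsubC.
pose c j := f`_j * rho ^+ j / f`_0.
have f00 : f`_0 != 0 by rewrite u0 oppr_eq0.
have cE j : c j = - q`_j * (- (q`_1)^-1) ^+ j.
  have -> : c j = f`_j * (a * - (q`_1)^-1) ^+ j / f`_0 by rewrite mulrN -mulNr -rhoE.
  rewrite exprMn mulrA uq u0; move: (_ ^+ j) => e.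
  by field; rewrite oppr_eq0.
pose M : {poly L} := \poly_(i < n.+2) c (n.+1 - i)%N.
have cO j : (2 <= j)%N -> c j \in mm.
  move=> j2; rewrite cE max_idealMr ?rpredX ?rpredN // max_idealN //.
  have := hq j; rewrite coefB coefB coefX coef1.
  by case: j j2 => [|[|j]] //; rewrite subr0 subr0.
have c0 : c 0 = 1 by rewrite /c expr0 mulr1 divff.
have c1 : c 1 = 1.
  by rewrite /c expr1 /rho mulrCA divff ?mulr1 ?divff.
have rhoE' : rho \in E by rewrite rpred_div // (polyOverP fE).
have cE' j : c j \in E.
  by rewrite /c rpred_div ?rpredM ?rpredX // (polyOverP fE).
have coefM' i : (M - 'X^n * ('X + 1))`_i \in mm.
  rewrite coefB /M coef_poly mulrDr mulr1 -exprSr coefD !coefXn.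
  case: ltnP => hi; last first.
    by rewrite !gtn_eqF ?addr0 ?subrr ?max_ideal0 // ltnW.
  have [->|hn] := eqVneq i n.+1; first by rewrite subnn c0 gtn_eqF // addr0 subrr max_ideal0.
  have [->|hn'] := eqVneq i n; first by rewrite subSnn c1 add0r subrr max_ideal0.
  by rewrite add0r subr0 cO // ltn_subRL addn1 ltnS ltn_neqAle hn' -ltnS ltn_neqAle hn.
have sM : size M = n.+2.
  by rewrite size_poly_eq // subnn c0 oner_eq0.
have Mmon : M \is monic.
  by rewrite monicE lead_coefE sM /M coef_poly ltnSn subnn c0.
have ME : M \is a polyOver E.
  by apply/polyOverP => i; rewrite coef_poly; case: ifP; rewrite ?rpred0.
have MO : M \is a polyOver O.
  apply/polyOverP => i; rewrite -[M](subrK ('X^n * ('X + 1))) coefD.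
  rewrite rpredD //; first exact: max_idealW.
  by rewrite mulrDr mulr1 -exprSr coefD !coefXn rpredD ?rpred_nat.
have m1O : -1 \in O by rewrite rpredN rpred1.
case: (henE (a := -1) Mmon ME MO _ m1O).
- by rewrite rpredN rpred1.
- have := max_ideal_horner val_total coefM' m1O.
  by rewrite hornerD hornerN hornerM hornerD hornerX hornerC addNr mulr0 subr0.
- have dO i : ((M - 'X^n * ('X + 1))^`())`_i \in mm.
    by rewrite coef_deriv -mulr_natr max_idealMr ?rpred_nat.
  have := max_ideal_horner val_total dO m1O.
  rewrite derivB hornerD hornerN => /(max_ideal_congr val_total) ->.
  rewrite derivM derivD derivX derivC addr0 mulr1 hornerD !hornerM hornerD.
  rewrite hornerX hornerC addNr mulr0 add0r hornerXn.
  by rewrite max_idealE ?expf_neq0 ?oppr_eq0 ?oner_eq0 // negbK -exprVn invrN1 rpredX.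
move=> R RE [rM]; rewrite opprK => hR.
have R0 : R != 0.
  by apply: contraTneq hR => ->; rewrite add0r max_ideal1.
have RO : R \in O by rewrite -[R](addrK 1) rpredB ?rpred1 // max_idealW.
have Rn : R \notin mm.
  apply: contra (max_ideal1 (O := O)) => h.
  by rewrite -[1](addKr R) max_idealD ?max_idealN.
have fR : root f (rho / R).
  have : f.[rho / R] * R ^+ n.+1 = f`_0 * M.[R].
    rewrite horner_coef sf /M horner_poly mulr_suml mulr_sumr.
    rewrite (reindex_inj rev_ord_inj) /=; apply: eq_bigr => i _.
    rewrite subSS /c exprMn mulrA [f`_0 * _]mulrC [in RHS]mulrAC divfK //.
    rewrite -!mulrA; congr (_ * (_ * _)).
    have -> : R ^+ n.+1 = R ^+ (n.+1 - i) * R ^+ i by rewrite -exprD subnK // -ltnS.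
    by rewrite mulrA exprVn mulVf ?mul1r // expf_neq0.
  rewrite (rootP rM) mulr0 => /eqP; rewrite mulf_eq0 expf_eq0 (negPf R0).
  by rewrite andbF orbF.
(* The root [rho / R] must be [a]: for [z] in [r] the quotient [a / z] is in the maximal ideal,
   whereas [a / (rho / R) = - q_1 R] is a unit. *)
move: fR; rewrite /f rootM root_XsubC root_prod_XsubC => /orP[/eqP <-|].
  by rewrite rpred_div.
move=> /hr[_].
have -> : a / (rho / R) = - (q`_1 * R) by rewrite rhoE; field; rewrite ?oppr_eq0 ?R0 ?a0 ?q10.
move=> /max_idealN; rewrite opprK => h.
case/negP: q1n; rewrite -[q`_1](mulfK R0) max_idealMr //.
exact: unit_inv.
Qed.

Lemma comp_XsubC_shift (b z : L) :
  ('X - z%:P) \Po ('X + b%:P) = 'X - (z - b)%:P.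
Proof. by rewrite comp_polyB comp_polyX comp_polyC polyCB opprB addrA. Qed.

(** Substituting [X + b] for [X] moves the centre of [newton_at0] from [0] to [b]. *)
Lemma newton a b (r : seq L) :
    ('X - a%:P) * \prod_(z <- r) ('X - z%:P) \is a polyOver E ->
    b \in E -> {in r, forall z, z != b /\ (b - a) / (b - z) \in mm} -> a \in E.
Proof.
move=> fE bE hr; rewrite -[a](subrK b) rpredD //.
apply: (@newton_at0 _ [seq z - b | z <- r]) => [|_ /mapP[z /hr[zb h] ->]]; last first.
  by rewrite subr_eq0 zb -[a - b]opprB -[z - b]opprB invrN mulrNN.
rewrite big_map; have := polyOver_comp fE (_ : 'X + b%:P \is a polyOver E).
rewrite rpredD ?polyOverX ?polyOverC // => /(_ isT).
rewrite rmorphM rmorph_prod /= comp_XsubC_shift.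
by under eq_bigr do rewrite comp_XsubC_shift.
Qed.

End Newton.

(** * Symmetric functions of the roots *)

Section SymmetricFunctions.
Context {L : fieldType} {E : subringClosed L} (n : nat) (cs : n.-tuple L).
Hypothesis csE : \prod_(c <- cs) ('X - c%:P) \is a polyOver E.

(** By the fundamental theorem of symmetric polynomials over the integers, [q] is a polynomial in
    the elementary symmetric ones, whose values at the roots are coefficients of the given product
    up to sign. *)
Lemma sym_roots_in (q : {mpoly int[n]}) :
  q \is symmetric -> mmap intr (tnth cs) q \in E.
Proof.
move=> /sym_fundamental[t [<- _]]; rewrite comp_mpolyEX raddf_sum rpred_sum // => m _ /=.
rewrite mmapZ rpredM ?rpred_int // comp_mpolyX rmorph_prod rpred_prod // => i _ /=.
rewrite rmorphXn rpredX //= tnth_mktuple.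
have -> : mmap intr (tnth cs) (mesym n int i.+1) = (mesym n L i.+1).@[tnth cs].
  rewrite /mesym !raddf_sum /=; apply: eq_bigr => A _; rewrite !rmorph_prod /=.
  by apply: eq_bigr => j _; rewrite /= mmapX mmap1U mevalXU.
have /= h := mroots_coeff cs (Ordinal (ltn_ord i : i.+1 < n.+1)%N).
rewrite -[_.@[_]](signrMK i.+1) -h rpredM ?rpredX ?rpredN ?rpred1 //.
exact: (polyOverP csE).
Qed.

(** A permutation of the indeterminates permutes the [m]-subsets, hence fixes the generic polynomial
    [P], whose coefficients are therefore symmetric. *)
Lemma subset_products_over (m : nat) :
  \prod_(A : {set 'I_n} | #|A| == m) ('X - (\prod_(i in A) tnth cs i)%:P)
    \is a polyOver E.
Proof.
pose P : {poly {mpoly int[n]}} :=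
  \prod_(A : {set 'I_n} | #|A| == m) ('X - (\prod_(i in A) 'X_i)%:P).
have -> : \prod_(A : {set 'I_n} | #|A| == m) ('X - (\prod_(i in A) tnth cs i)%:P) =
    map_poly (mmap intr (tnth cs)) P.
  rewrite /P rmorph_prod; apply: eq_bigr => A _ /=.
  rewrite rmorphB /= map_polyX map_polyC /= [mmap _ _ _]rmorph_prod.
  by congr (_ - polyC _); apply: eq_bigr => j _; rewrite /= mmapX mmap1U.
apply/polyOverP => i; rewrite coef_map; apply: sym_roots_in.
apply/issymP => s; rewrite -coef_map; suff -> : map_poly (msym s) P = P by [].
rewrite /P rmorph_prod [RHS](reindex_inj (imset_inj (@perm_inj _ s))) /=.
apply: eq_big => [A|A _]; first by rewrite card_imset //; exact: perm_inj.
rewrite rmorphB /= map_polyX map_polyC /= [msym _ _]rmorph_prod.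
rewrite big_imset /=; last by move=> x y _ _; exact: perm_inj.
congr (_ - polyC _); apply: eq_bigr => j _.
by rewrite /= /msym mmapX mmap1U.
Qed.

End SymmetricFunctions.

(** Newton interpolation: the quotient of [p - p(c)] by [X - c] has lower degree and takes values in
    [E] at the remaining nodes. *)
Lemma polyOver_interpolation (L : fieldType) (E : divringClosed L) (s : seq L)
    (p : {poly L}) :
    uniq s -> (size p <= size s)%N -> {in s, forall c, c \in E /\ p.[c] \in E} ->
  p \is a polyOver E.
Proof.
elim: s p => [|c s IH] p; first by rewrite leqn0 size_poly_eq0 => _ /eqP -> _; exact: rpred0.
move=> /andP[cs us] sp h; have [cE pcE] := h c (mem_head _ _).
have : root (p - p.[c]%:P) c by rewrite rootE !hornerE subrr.
move=> /factor_theorem[q qE].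
have pE : p = q * ('X - c%:P) + p.[c]%:P by rewrite -qE subrK.
rewrite pE rpredD ?polyOverC // rpredM ?polyOverXsubC //.
apply: IH => // [|d ds].
  have [->|q0] := eqVneq q 0; first by rewrite size_poly0.
  have : (size (p - (p.[c])%:P)%R <= (size s).+1)%N.
    rewrite (leq_trans (size_polyD _ _)) // size_polyN geq_max sp.
    by rewrite (leq_trans (size_polyC_leq1 _)).
  by rewrite qE size_Mmonic ?monicXsubC // size_XsubC addn2.
have [dE pdE] := h d (mem_behead (s := c :: s) ds).
split=> //; have dc : d - c != 0 by rewrite subr_eq0; apply: contraNneq cs => <-.
have -> : q.[d] = (p.[d] - p.[c]) / (d - c).
  by rewrite {1}pE !hornerE addrK mulfK.
by rewrite rpred_div ?rpredB.
Qed.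

(** * Clusters of roots over a henselian field *)

Section Clusters.
Context {L : fieldType} {O : subringClosed L} {E : divringClosed L}.
Hypothesis val_total : forall x, x \in O \/ x^-1 \in O.
Hypothesis henE : hensel O E.
Local Notation mm := (max_ideal O).

Lemma prod_mm (I : finType) (A : {set I}) (F : I -> L) :
  A != finset.set0 -> {in A, forall i, F i \in mm} -> \prod_(i in A) F i \in mm.
Proof.
case/set0Pn => i iA h; rewrite (bigD1 i) //= max_idealMr ?h //.
by rewrite rpred_prod // => j /andP[jA _]; apply: max_idealW => //; apply: h.
Qed.

(* Among the products of [#|S0|] roots, the one over the cluster [S0] has the
   strictly largest value, so Newton's lemma applies to the polynomial whose
   roots are all these products. *)
Lemma cluster_prod n (cs : n.-tuple L) t :
    \prod_(c <- cs) ('X - c%:P) \is a polyOver E -> t != 0 ->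
  \prod_(i | tnth cs i / t \in O) tnth cs i \in E.
Proof.
move=> csE t0; pose S0 : {set 'I_n} := finset (fun i => tnth cs i / t \in O).
pose s (A : {set 'I_n}) := \prod_(i in A) tnth cs i.
have -> : \prod_(i | tnth cs i / t \in O) tnth cs i = s S0.
  by apply: eq_bigl => i; rewrite inE.
have [->|s0] := eqVneq (s S0) 0; first exact: rpred0.
have := subset_products_over csE #|S0|; rewrite (bigD1 S0) //= -/(s S0).
rewrite -(big_image _ _ s [pred A : {set 'I_n} | (#|A| == #|S0|) && (A != S0)]
  (fun z => 'X - z%:P)) => h; apply: (newton_at0 val_total henE h) => {h}.
move=> z /mapP[A]; rewrite mem_enum => /andP[/eqP cA AS0] ->; rewrite -/(s A).
have far i : i \in A :\: S0 -> t / tnth cs i \in mm.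
  by rewrite !inE => /andP[h _]; rewrite -[t / _]invf_div; apply: invr_notin.
have farN i : i \in A :\: S0 -> tnth cs i != 0.
  by rewrite !inE => /andP[h _]; apply: contraNneq h => ->; rewrite mul0r rpred0.
have sI : s (S0 :&: A) != 0.
  by move: s0; rewrite /s (big_setID A) /= mulf_eq0 negb_or => /andP[].
have sD : s (A :\: S0) != 0 by apply/prodf_neq0 => i /farN.
have sAE : s A = s (S0 :&: A) * s (A :\: S0) by rewrite /s (big_setID S0) /= finset.setIC.
split; first by rewrite sAE mulf_neq0.
have cD : #|S0 :\: A| = #|A :\: S0|.
  by apply/eqP; rewrite -(eqn_add2l #|S0 :&: A|) cardsID finset.setIC cardsID cA.
(* Since [A] and [S0] have the same size, the powers of [t] cancel. Roots in the cluster give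
   factors in [O], roots outside it give factors in the maximal ideal, and [A <> S0] ensures that
   the latter occur. *)
have -> : s S0 / s A = \prod_(i in S0 :\: A) (tnth cs i / t) *
                       \prod_(i in A :\: S0) (t / tnth cs i).
  have -> : s S0 = s (S0 :&: A) * s (S0 :\: A) by rewrite /s (big_setID A).
  rewrite sAE !big_split /= !prodr_const prodfV -/(s _) -/(s (A :\: S0)) cD.
  by rewrite exprVn; field; rewrite expf_neq0 // sI sD.
apply: max_idealMl; first by rewrite rpred_prod // => i; rewrite !inE => /andP[].
apply: prod_mm => //; rewrite -card_gt0 -cD card_gt0 finset.setD_eq0; apply: contra AS0 => sub.
by rewrite eq_sym eqEcard sub cA leqnn.
Qed.

(* Translating by elements of [E] that do not move the cluster shows that its
   polynomial takes values in [E] at enough points to interpolate it. *)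
Lemma cluster_poly0 (r : seq L) t (u : seq L) :
    \prod_(c <- r) ('X - c%:P) \is a polyOver E -> t != 0 ->
    uniq u -> (size r < size u)%N -> {in u, forall c, c \in E /\ c / t \in O} ->
  \prod_(c <- r | c / t \in O) ('X - c%:P) \is a polyOver E.
Proof.
move=> rE t0 uu su hu; apply: (@polyOver_interpolation _ _ u) => // [|c cu].
  rewrite -big_filter size_prod_XsubC size_filter.
  by rewrite (leq_ltn_trans (count_size _ _)).
have [cE cO] := hu c cu; split=> //.
have shE : \prod_(d <- map_tuple (fun d => d - c) (in_tuple r)) ('X - d%:P) \is a polyOver E.
  rewrite big_map; have := polyOver_comp rE (_ : 'X + c%:P \is a polyOver E).
  rewrite rpredD ?polyOverX ?polyOverC // => /(_ isT).
  by rewrite rmorph_prod /=; under eq_bigr do rewrite comp_XsubC_shift.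
have := cluster_prod shE t0.
have -> : \prod_(i | tnth (map_tuple (fun d => d - c) (in_tuple r)) i / t \in O)
    tnth (map_tuple (fun d => d - c) (in_tuple r)) i = \prod_(d <- r | d / t \in O) (d - c).
  rewrite [RHS]big_tnth; apply: eq_big => [i|i _]; rewrite tnth_map //.
  by rewrite mulrBl rpredBr.
move=> h; rewrite horner_prod.
under eq_bigr do rewrite hornerXsubC -opprB -mulN1r.
by rewrite big_split rpredM // rpred_prod // => *; rewrite rpredN rpred1.
Qed.

Lemma cluster_poly (r : seq L) b t (u : seq L) :
    \prod_(c <- r) ('X - c%:P) \is a polyOver E -> t != 0 -> b \in E ->
    uniq u -> (size r < size u)%N -> {in u, forall c, c \in E /\ c / t \in O} ->
  \prod_(c <- r | (c - b) / t \in O) ('X - c%:P) \is a polyOver E.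
Proof.
move=> rE t0 bE uu su hu.
have shE c : c \in E -> 'X + c%:P \is a polyOver E.
  by move=> cE; rewrite rpredD ?polyOverX ?polyOverC.
have := @cluster_poly0 [seq c - b | c <- r] t u; rewrite size_map !big_map.
have := polyOver_comp rE (shE b bE).
rewrite rmorph_prod /=; under eq_bigr do rewrite comp_XsubC_shift.
move=> h /(_ h t0 uu su hu) /polyOver_comp /(_ (shE (- b) _)).
rewrite rpredN => /(_ bE).
rewrite rmorph_prod /=; under eq_bigr do rewrite comp_XsubC_shift opprK subrK.
by [].
Qed.

End Clusters.

(** * Separability and division with remainder *)

(** Long division by a monic polynomial uses no inverses, so it works over subfields and over the
    valuation ring [O] alike. *)
Lemma edivp_over (L : fieldType) (S : subringClosed L) (h r : {poly L}) :
    h \is monic -> h \is a polyOver S -> r \is a polyOver S ->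
  exists q s, [/\ r = q * h + s, (size s < size h)%N,
                  q \is a polyOver S & s \is a polyOver S].
Proof.
move=> hm hS; have [n] := ubnP (size r); elim: n r => // n IH r rn rS.
have [small|big] := ltnP (size r) (size h).
  by exists 0, r; split; rewrite ?mul0r ?add0r ?rpred0.
have h0 : h != 0 by exact: monic_neq0.
have r0 : r != 0 by rewrite -size_poly_gt0 (leq_trans _ big) // size_poly_gt0.
pose u := lead_coef r *: 'X^(size r - size h).
have uS : u \is a polyOver S.
  by rewrite polyOverZ ?polyOverXn // lead_coefE (polyOverP rS).
have su : size (u * h) = size r.
  rewrite size_Mmonic //; last by rewrite scaler_eq0 negb_or lead_coef_eq0 r0 monic_neq0 ?monicXn.
  rewrite size_scale ?lead_coef_eq0 // size_polyXn.
  by rewrite addSn /= subnK.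
have lu : lead_coef (u * h) = lead_coef r.
  by rewrite lead_coef_Mmonic // lead_coefZ lead_coefXn mulr1.
have lt : (size (r - u * h)%R < size r)%N.
  rewrite -[ltnRHS]prednK ?size_poly_gt0 // ltnS; apply/leq_sizeP => j.
  rewrite leq_eqVlt prednK ?size_poly_gt0 // coefB => /orP[/eqP<-|rj].
    by rewrite -{2}su -!lead_coefE lu subrr.
  by rewrite !nth_default ?su ?subrr.
have [|q [s [E sh qS sS]]] := IH (r - u * h) (leq_trans lt rn).
  by rewrite rpredB ?rpredM.
exists (q + u), s; split=> //; last exact: rpredD.
by rewrite mulrDl addrAC -E subrK.
Qed.

Lemma modp_over (L : fieldType) (S : subringClosed L) (h r : {poly L}) :
    h \is monic -> h \is a polyOver S -> r \is a polyOver S ->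
  r %% h \is a polyOver S.
Proof.
by move=> hm hS rS; have [q [s [/modpP E /E <-]]] := edivp_over hm hS rS.
Qed.

(* [y] is both separable and purely inseparable over [M]. *)
Lemma separable_pth_root_in (L : fieldType) (M : divringClosed L) (p : nat) (f : {poly L}) y :
    p \in [pchar L] -> f \is a polyOver M -> root f y -> f^`().[y] != 0 ->
  y ^+ p \in M -> y \in M.
Proof.
move=> pL fM fy f'y ypM; have p_gt0 := prime_gt0 (pcharf_prime pL).
pose h : {poly L} := 'X^p - (y ^+ p)%:P.
have hE : h = ('X - y%:P) ^+ p.
  have pn : [pchar {poly L}].-nat p.
    by rewrite (eq_pnat _ (pchar_poly L)) pnatE ?(pcharf_prime pL).
  by rewrite /h exprDn_pchar // exprNn_pchar // polyC_exp.
have hm : h \is monic by rewrite hE monic_exp // monicXsubC.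
have hM : h \is a polyOver M by rewrite rpredB ?polyOverXn ?polyOverC.
have sh : size h = p.+1 by rewrite size_XnsubC.
pose P n := `[< exists r : {poly L}, [/\ r \is a polyOver M, r != 0, root r y & size r = n] >].
(* The remainder of [f] modulo [h = (X - y)^p] is nonzero, as [h] and [h'] vanish at [y] but [f']
   does not. So [y] has degree less than [p] over [M]. *)
have [n0 [n0p Pn0]] : exists n, (n <= p)%N /\ P n.
  have [q [r [E sr qM rM]]] := edivp_over hm hM fM.
  have hy : root h y by rewrite rootE /h !hornerE subrr.
  have h'y : h^`().[y] = 0.
    rewrite /h derivB derivXn derivC subr0.
    by rewrite hornerMn hornerXn -mulr_natr (pcharf0 pL) mulr0.
  exists (size r); split; first by rewrite -ltnS -sh.
  apply/asboolP; exists r; split=> //.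
    apply: contraNneq f'y => r0; rewrite E r0 addr0 derivM hornerD !hornerM.
    by rewrite h'y (rootP hy) !mulr0 addr0.
  by move: fy; rewrite E !rootE hornerD hornerM (rootP hy) mulr0 add0r.
have exP : exists n, P n by exists n0.
case: (ex_minnP exP) => n /asboolP[r [rM r0 ry sr]] nmin.
have np : (n <= p)%N := leq_trans (nmin _ Pn0) n0p.
have lM : lead_coef r \in M by rewrite lead_coefE (polyOverP rM).
have l0 : lead_coef r != 0 by rewrite lead_coef_eq0.
pose g := (lead_coef r)^-1 *: r.
have gm : g \is monic by rewrite monicE lead_coefZ mulVf.
have gM : g \is a polyOver M by rewrite polyOverZ // rpredV.
have sg : size g = n by rewrite size_scale ?invr_eq0.
have gy : root g y by rewrite rootZ ?invr_eq0.
have gh : g %| h.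
  have [q [s [E ss qM sM]]] := edivp_over gm gM hM.
  apply/dvdpP; exists q; rewrite {1}E; apply/eqP; rewrite -subr_eq0 addrC addKr.
  apply: contraTT ss => s0; rewrite -leqNgt sg; apply: nmin; apply/asboolP.
  exists s; split=> //; have : h.[y] = 0 by rewrite /h !hornerE subrr.
  by rewrite E hornerD hornerM (rootP gy) mulr0 add0r => /eqP.
move: gh; rewrite hE => /dvdp_exp_XsubCP[k _ gk].
have {gk} gE : g = ('X - y%:P) ^+ k.
  by apply/eqP; rewrite -eqp_monic // monic_exp // monicXsubC.
have sgk : n = k.+1 by rewrite -sg gE size_exp_XsubC.
have k0 : k != 0%N.
  by apply: contraTneq gy => k0; rewrite gE k0 expr0 root1.
(* Now [g = (X - y)^k] with [0 < k < p], so [y] can be recovered from its second coefficient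
   [- k y]. *)
have gk1 : g`_k.-1 = - (k%:R * y).
  have := @coefPn_prod_XsubC _ (nseq k y); rewrite size_nseq => /(_ k0).
  by rewrite !big_nseq iter_mulr_1 -gE iter_addr_0 mulr_natl.
have kn0 : k%:R != 0 :> L.
  rewrite -(dvdn_pcharf pL); apply: contraTN np => /dvdn_leq.
  by rewrite lt0n sgk -ltnNge ltnS => ->.
rewrite -[y](mulKf kn0) -[k%:R * y]opprK -gk1 rpredM ?rpredV ?rpred_nat //.
by rewrite rpredN (polyOverP gM).
Qed.

(** Take [f] of least size. If [f'(y) = 0], minimality gives [f' = 0], so [f] is a polynomial in
    [X^p]; perfectness makes it the [p]-th power of a smaller polynomial over [K] that still
    vanishes at [y]. *)
Lemma perfect_separable (L : fieldType) (K : divringClosed L) (p : nat) y :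
    p \in [pchar L] -> {in K, forall a, exists2 b, b \in K & b ^+ p = a} ->
    (exists f, [/\ f != 0, f \is a polyOver K & root f y]) ->
  exists f, [/\ f \is monic, f \is a polyOver K, root f y & f^`().[y] != 0].
Proof.
move=> pL perfK [f0 [f00 f0K f0y]].
pose P n := `[< exists r : {poly L}, [/\ r \is a polyOver K, r != 0, root r y & size r = n] >].
have exP : exists n, P n by exists (size f0); apply/asboolP; exists f0.
case: (ex_minnP exP) => n /asboolP[f [fK fn0 fy sf]] nmin.
have f'0 : f^`().[y] != 0.
  apply/negP => f'y.
  have Df : f^`() = 0.
    apply/eqP/negPn/negP => Df0.
    have : (n <= size f^`())%N.
      by apply: nmin; apply/asboolP; exists f^`(); split=> //; exact: polyOver_deriv.
    by rewrite leqNgt -sf lt_size_deriv.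
  have fi i : ~~ (p %| i)%N -> f`_i = 0.
    case: i => [|i] pi; first by rewrite dvdn0 in pi.
    have /eqP := congr1 (fun q : {poly L} => q`_i) Df.
    rewrite coef_deriv coef0 -mulr_natr mulf_eq0 -(dvdn_pcharf pL) (negPf pi) orbF.
    by move/eqP.
  have [g gP] : exists g : nat -> L, forall i, g i \in K /\ g i ^+ p = f`_(p * i).
    have h i : exists b, b \in K /\ b ^+ p = f`_(p * i).
      by have [b] := perfK _ (polyOverP fK (p * i)%N); exists b.
    by exists (fun i => sval (cid (h i))) => i; exact: (svalP (cid (h i))).
  have p1 := prime_gt1 (pcharf_prime pL); have p0 := ltnW p1.
  pose k := \poly_(i < size f) g i.
  have kP j : k`_j ^+ p = f`_(p * j).
    rewrite coef_poly; case: ltnP => [_|fj]; first exact: (gP j).2.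
    by rewrite expr0n gtn_eqF // nth_default // (leq_trans fj) // leq_pmull.
  have fE : f = map_poly (pFrobenius_aut pL) k \Po 'X^p.
    apply/polyP => i; rewrite coef_comp_poly_Xn // coef_map /= pFrobenius_autE.
    by case: (boolP (p %| i)%N) => [pi|/fi //]; rewrite kP mulnC divnK.
  have k0 : k != 0.
    by apply: contraNneq fn0 => k0; rewrite fE k0 map_poly0 comp_poly0.
  have ky : root k y.
    have := rootP fy; rewrite {1}fE horner_comp hornerXn -(pFrobenius_autE pL) horner_map /=.
    by move/eqP; rewrite pFrobenius_autE expf_eq0 p0.
  have kK : k \is a polyOver K.
    by apply/polyOverP => j; rewrite coef_poly; case: ifP => _; rewrite ?rpred0 // (gP j).1.
  have sf1 : (1 < size f)%N by exact: root_size_gt1 fy.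
  have sk : (size k <= (size f).-1)%N.
    apply/leq_sizeP => j; rewrite -subn1 leq_subLR add1n => fj.
    have := kP j; rewrite [RHS]nth_default.
      by move/eqP; rewrite expf_eq0 p0 => /eqP.
    rewrite (leq_trans fj) // (@leq_trans (2 * j)) ?leq_mul2r ?p1 ?orbT //.
    by rewrite mul2n -addnn -addn1 leq_add2l -ltnS (leq_trans sf1).
  have : (n <= size k)%N by apply: nmin; apply/asboolP; exists k.
  by rewrite leqNgt -sf (leq_ltn_trans sk) // prednK // ltnW.
exists ((lead_coef f)^-1 *: f); split.
- by rewrite monicE lead_coefZ mulVf // lead_coef_eq0.
- by rewrite polyOverZ // rpredV lead_coefE (polyOverP fK).
- by rewrite rootZ // invr_eq0 lead_coef_eq0.
- by rewrite derivZ hornerZ mulf_neq0 // invr_eq0 lead_coef_eq0.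
Qed.

(** The power [y^p] is again algebraic over [K], so the [p]-th roots can be taken one at a time. *)
Lemma separable_pth_root_iter (L : fieldType) (K M : divringClosed L) (p : nat) y k :
    p \in [pchar L] -> {subset K <= M} ->
    {in K, forall a, exists2 b, b \in K & b ^+ p = a} ->
    (exists f, [/\ f != 0, f \is a polyOver K & root f y]) ->
  y ^+ (p ^ k) \in M -> y \in M.
Proof.
move=> pL KM perfK; elim: k y => [|k IH] y [f [f0 fK fy]]; first by rewrite expr1.
move=> yM; have [|g [gm gK gy g'y]] := perfect_separable (y := y) pL perfK.
  by exists f.
apply: (separable_pth_root_in pL _ gy g'y); first exact: polyOverS gK.
apply: IH; last by rewrite -exprM -expnS.
exists (map_poly (pFrobenius_aut pL) f); split; first by rewrite map_poly_eq0.
  by apply/polyOverP => i; rewrite coef_map /= pFrobenius_autE rpredX // (polyOverP fK).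
by rewrite -(pFrobenius_autE pL) rmorph_root.
Qed.

(** The scale [c] is a nonzero element of least value in [1 :: s]; its membership there keeps it in
    any subfield that contains [s]. *)
Lemma common_scale (L : fieldType) (O : subringClosed L) (s : seq L) :
    (forall x, x \in O \/ x^-1 \in O) ->
  exists c, [/\ c != 0, c \in 1 :: s & {in s, forall x, x / c \in O}].
Proof.
move=> val_total; elim: s => [|x s [c [c0 cs IH]]].
  by exists 1; rewrite oner_eq0 mem_head.
have cs' : c \in [:: 1, x & s] by move: cs; rewrite !inE => /orP[|] ->; rewrite ?orbT.
case: (val_total (x / c)) => xc.
  by exists c; split=> // y; rewrite inE => /orP[/eqP->|/IH].
have [x0|x0] := eqVneq x 0.
  exists c; split=> // y; rewrite inE => /orP[/eqP->|/IH //].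
  by rewrite x0 mul0r rpred0.
exists x; split=> //; first by rewrite !inE eqxx orbT.
move=> y; rewrite inE => /orP[/eqP->|/IH ys]; first by rewrite divff ?rpred1.
have -> : y / x = (y / c) * (x / c)^-1 by field; rewrite x0 c0.
exact: rpredM.
Qed.

(* After the substitution [X = b + t T] the modulus is integral; [c] absorbs [g]
   and the coefficients of the inverse substitution, and is independent of [q]. *)
Lemma cluster_mod_bound (L : fieldType) (O : subringClosed L) (s : seq L) (b t : L)
    (g : {poly L}) n :
    (forall x, x \in O \/ x^-1 \in O) -> t != 0 ->
    {in s, forall z, (z - b) / t \in O} ->
  exists2 c, c != 0 & forall q,
    ((('X - b%:P) ^+ q * g) %% (\prod_(z <- s) ('X - z%:P)))`_n / (c * t ^+ q) \in O.
Proof.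
move=> val_total t0 hs; set h := \prod_(z <- s) _.
pose g1 := g \Po (t *: 'X + b%:P); pose u := t^-1 *: ('X - b%:P).
have [c1 [c10 _ hc1]] := common_scale (polyseq g1) val_total.
have [c2 [c20 _ hc2]] := common_scale [seq (u ^+ i)`_n | i <- iota 0 (size s)] val_total.
pose H := \prod_(z <- s) ('X - ((z - b) / t)%:P).
have Hm : H \is monic by exact: monic_prod_XsubC.
have HO : H \is a polyOver O.
  by rewrite /H big_seq rpred_prod // => z zs; rewrite polyOverXsubC hs.
have sH : size H = (size s).+1 by rewrite size_prod_XsubC.
have sh : size h = (size s).+1 by rewrite size_prod_XsubC.
have uK : (t *: 'X + b%:P) \Po u = 'X.
  rewrite comp_polyD comp_polyZ comp_polyX comp_polyC /u scalerA divff // scale1r.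
  by rewrite subrK.
have Hu : H \Po u = t^-1 ^+ size s *: h.
  have fac z : ('X - ((z - b) / t)%:P) \Po u = t^-1 *: ('X - z%:P).
    rewrite comp_polyB comp_polyX comp_polyC [_ / t]mulrC polyCM mul_polyC.
    by rewrite -scalerBr polyCB opprB addrA subrK.
  rewrite /H rmorph_prod /= /h; elim: (s) => [|z r IH]; first by rewrite !big_nil scale1r.
  by rewrite !big_cons {}IH fac exprS -scalerAl -scalerAr scalerA.
exists (c1 * c2); first by rewrite mulf_neq0.
move=> q; have T_O : 'X^q * (c1^-1 *: g1) \is a polyOver O.
  rewrite rpredM ?polyOverXn //; apply/polyOverP => i; rewrite coefZ mulrC.
  have [sg|sg] := leqP (size g1) i; first by rewrite nth_default // mul0r rpred0.
  by rewrite hc1 // mem_nth.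
have [Q [R [E sR QO RO]]] := edivp_over Hm HO T_O.
have := congr1 (fun r => r \Po u) E.
rewrite rmorphM rmorphXn /= comp_polyX comp_polyZ -comp_polyA uK comp_polyXr.
rewrite rmorphD rmorphM /= Hu => {}E.
(* The last summand has smaller size than [h], so it is the remainder; [q] enters its coefficients
   only through [t^q] and the integral polynomial [R]. *)
have E2 : ('X - b%:P) ^+ q * g =
    ((t ^+ q * c1 * t^-1 ^+ size s) *: (Q \Po u)) * h + (t ^+ q * c1) *: (R \Po u).
  have -> : ('X - b%:P) ^+ q * g = (t ^+ q * c1) *: (u ^+ q * (c1^-1 *: g)).
    rewrite /u exprZn -scalerAr -scalerAl !scalerA.
    rewrite -[LHS]scale1r; congr (_ *: _).
    by rewrite exprVn; field; rewrite c10 expf_neq0.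
  by rewrite E scalerDr -scalerAr scalerA -scalerAl.
have sRu : (size (R \Po u) < size h)%N.
  rewrite size_comp_poly2 ?sh -?sH // /u size_scale ?invr_eq0 ?size_XsubC //.
rewrite -(modpP E2); last by rewrite (leq_ltn_trans (size_scale_leq _ _)).
rewrite coefZ coef_comp_poly.
have -> : t ^+ q * c1 * (\sum_(i < size R) R`_i * (u ^+ i)`_n) / (c1 * c2 * t ^+ q) =
   \sum_(i < size R) R`_i * ((u ^+ i)`_n / c2).
  under [in RHS]eq_bigr do rewrite mulrA.
  by rewrite -mulr_suml; field; rewrite c10 c20 expf_neq0.
rewrite rpred_sum // => i _; rewrite rpredM ?(polyOverP RO) // hc2 //.
apply/mapP; exists (i : nat) => //; rewrite mem_iota /=.
by rewrite (leq_trans (ltn_ord i)) // -ltnS -sH.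
Qed.

(** * Algebraic closure inside the ambient field *)

Section SubfieldType.
Context {L : fieldType} (K : divringClosed L).

(** Turns [K] into a field with embedding [val], so that results on [algebraicOver] apply. *)
Definition subfield_type := {x : L | x \in K}.
HB.instance Definition _ := SubChoice.on subfield_type.
HB.instance Definition _ := [SubChoice_isSubIntegralDomain of subfield_type by <:].
HB.instance Definition _ := [SubIntegralDomain_isSubField of subfield_type by <:].

Lemma polyOver_map_val (f : {poly L}) :
  f \is a polyOver K <-> exists g, f = map_poly (val : subfield_type -> L) g.
Proof.
split=> [/polyOverP fK|[g ->]]; last by apply/polyOverP => i; rewrite coef_map (valP g`_i).
exists (\poly_(i < size f) Sub f`_i (fK i)); apply/polyP => i.
rewrite coef_map coef_poly; case: ltnP => [_|h]; first exact/esym/SubK.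
by rewrite nth_default // raddf0.
Qed.

Definition algebraic_in : {pred L} :=
  [pred y | `[< exists f, [/\ f != 0, f \is a polyOver K & root f y] >]].

Lemma algebraic_inE y :
  y \in algebraic_in <-> algebraicOver (val : subfield_type -> L) y.
Proof.
rewrite inE; split=> [[f [f0 /polyOver_map_val[g E] fy]]|[g g0 gy]].
  by exists g; rewrite -?E //; apply: contraNneq f0 => g0; rewrite E g0 map_poly0.
exists (map_poly (val : subfield_type -> L) g); split=> //.
  by rewrite map_poly_eq0.
by apply/polyOver_map_val; exists g.
Qed.

Lemma algebraic_in_divring : divring_closed algebraic_in.
Proof.
split=> [|x y|x y]; rewrite !algebraic_inE.
- exact: algebraic1.
- exact: algebraic_sub.
- exact: algebraic_div.
Qed.

HB.instance Definition _ :=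
  GRing.isDivringClosed.Build L algebraic_in algebraic_in_divring.

Lemma algebraic_in_root (f : {poly L}) y :
  f != 0 -> f \is a polyOver algebraic_in -> root f y -> y \in algebraic_in.
Proof.
move=> f0 /polyOverP fK fy; apply/algebraic_inE/integral_algebraic.
apply: (integral_root f0 fy) => _ /(nthP 0)[i _ <-].
by apply/integral_algebraic/algebraic_inE.
Qed.

Lemma algebraic_in_sub : {subset K <= algebraic_in}.
Proof.
move=> x xK; rewrite inE; exists ('X - x%:P).
by rewrite polyXsubC_eq0 polyOverXsubC root_XsubC.
Qed.

End SubfieldType.

(** * Topological closure *)

Section Closure.
Context {L : fieldType} {O : subringClosed L} (S : divringClosed L) (pi : L).
Hypothesis val_total : forall x, x \in O \/ x^-1 \in O.
Hypotheses (pi0 : pi != 0) (pi_mm : pi \in max_ideal O).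
Local Notation mm := (max_ideal O).

(** Closure in the valuation topology: [(x - z) / e] in [O] says that the value of [x - z] is at
    least that of [e]. *)
Definition topological_closure : {pred L} :=
  [pred x | `[< forall e, e != 0 -> exists2 z, z \in S & (x - z) / e \in O >]].
Local Notation D := topological_closure.

Lemma closure_sub : {subset S <= D}.
Proof. by move=> x xS; rewrite inE => e e0; exists x; rewrite // subrr mul0r rpred0. Qed.

Lemma closureB x y : x \in D -> y \in D -> x - y \in D.
Proof.
rewrite !inE => xD yD e e0; have [z zS hz] := xD e e0; have [t tS ht] := yD e e0.
exists (z - t); first exact: rpredB.
have -> : (x - y - (z - t)) / e = (x - z) / e - (y - t) / e by field.
exact: rpredB.
Qed.

Lemma closureM x y : x \in D -> y \in D -> x * y \in D.
Proof.
have [->|x0] := eqVneq x 0; first by rewrite mul0r.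
rewrite !inE => xD yD e e0; have [|t tS ht] := yD (e / x).
  by rewrite mulf_neq0 ?invr_eq0.
(* The approximation of [x] will be made relative to [t], which must be nonzero; if [t = 0], then
   [x y / e] is already in [O]. *)
have [tz|t0] := eqVneq t 0.
  exists 0; first exact: rpred0.
  by move: ht; rewrite tz !subr0 invf_div mulrCA mulrA.
have [|z zS hz] := xD (e / t); first by rewrite mulf_neq0 ?invr_eq0.
exists (z * t); first exact: rpredM.
have -> : (x * y - z * t) / e = (y - t) / (e / x) + (x - z) / (e / t).
  by field; rewrite e0 x0 t0.
exact: rpredD.
Qed.

Lemma closureV x : x \in D -> x^-1 \in D.
Proof.
have [->|x0] := eqVneq x 0; first by rewrite invr0.
rewrite !inE => xD e e0.
(* Of [pi x] and [e x^2], [a] is one of larger value. The first bound makes [z / x] a unit, the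
   second gives the precision [e] for the inverses. *)
have [a a0 [ax ae]] : exists2 a, a != 0 & a / (pi * x) \in O /\ a / (e * x ^+ 2) \in O.
  have u0 : pi * x != 0 by rewrite mulf_neq0.
  have v0 : e * x ^+ 2 != 0 by rewrite mulf_neq0 ?expf_neq0.
  case: (val_total ((pi * x) / (e * x ^+ 2))) => h.
    by exists (pi * x) => //; rewrite divff ?rpred1.
  by exists (e * x ^+ 2) => //; rewrite divff ?rpred1 // -invf_div.
have [z zS hz] := xD a a0.
have h1 : z / x - 1 \in mm.
  have -> : z / x - 1 = - ((x - z) / a * (a / (pi * x)) * pi).
    by field; rewrite x0 pi0 a0.
  by rewrite max_idealN // max_idealMl // rpredM.
have h2 : z / x \notin mm by rewrite (max_ideal_congr val_total h1) max_ideal1.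
have h3 : z / x \in O by rewrite -[z / x](subrK 1) rpredD ?rpred1 // max_idealW.
have z0 : z != 0 by apply: contraNneq h2 => ->; rewrite mul0r max_ideal0.
exists z^-1; first by rewrite rpredV.
have -> : (x^-1 - z^-1) / e = - ((x - z) / a * (a / (e * x ^+ 2)) * (z / x)^-1).
  by field; rewrite x0 e0 a0 z0.
by rewrite rpredN; apply: rpredM; [exact: rpredM | exact: unit_inv].
Qed.

Lemma closure_divring : divring_closed D.
Proof.
split; first by apply: closure_sub; exact: rpred1.
  exact: closureB.
by move=> x y xD yD; apply: closureM => //; exact: closureV.
Qed.

End Closure.

(** Continuity of roots: if [k] over [S] approximates [f], then [k(x)] is small. As [k(x)] is the
    product of [x - z] over the roots [z] of [k], some root is close to [x], and all these roots are
    in [S]. *)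
Lemma closure_root (L : closedFieldType) (O : subringClosed L) (S : divringClosed L)
    (f : {poly L}) x :
    (forall x, x \in O \/ x^-1 \in O) ->
    (forall g y, g != 0 -> g \is a polyOver S -> root g y -> y \in S) ->
    f \is monic -> f \is a polyOver (@topological_closure L O S) -> root f x ->
  x \in @topological_closure L O S.
Proof.
move=> val_total algS fm fS fx.
have [->|x0] := eqVneq x 0; first by apply: closure_sub; exact: rpred0.
rewrite inE => e e0; pose n := (size f).-1.
have sf : size f = n.+1 by rewrite prednK // size_poly_gt0 monic_neq0.
have n0 : (0 < n)%N.
  by rewrite -ltnS -sf; apply: root_size_gt1 fx; exact: monic_neq0.
(* Precision [e^n / x^i] in degree [i] puts each [(f_i - g_i) x^i], and hence [k(x)], into
   [e^n O]. *)
have [g gP] : exists g : nat -> L, forall i, g i \in S /\ (f`_i - g i) / (e ^+ n / x ^+ i) \in O.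
  have h i : exists b, b \in S /\ (f`_i - b) / (e ^+ n / x ^+ i) \in O.
    have : f`_i \in @topological_closure L O S.
      have [fi|fi] := ltnP i (size f); first by apply: (allP fS); exact: mem_nth.
      by rewrite nth_default //; apply: closure_sub; exact: rpred0.
    rewrite inE => /(_ (e ^+ n / x ^+ i)) [|b]; last by exists b.
    by rewrite mulf_neq0 ?invr_eq0 ?expf_neq0.
  by exists (fun i => sval (cid (h i))) => i; exact: (svalP (cid (h i))).
pose k := 'X^n + \poly_(i < n) g i.
have km : k \is monic by rewrite monicE lead_coefDl ?lead_coefXn // size_polyXn ltnS size_poly.
have sk : size k = n.+1.
  by rewrite size_polyDl size_polyXn // ltnS size_poly.
have kS : k \is a polyOver S.
  rewrite rpredD ?polyOverXn //; apply/polyOverP => i; rewrite coef_poly.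
  by case: ifP => _; rewrite ?rpred0 // (gP i).1.
have kx : k.[x] / e ^+ n \in O.
  have -> : k.[x] = - \sum_(i < n) (f`_i - g i) * x ^+ i.
    have := rootP fx; rewrite horner_coef sf big_ord_recr /= -[n in f`_n]/(n.+1.-1) -sf.
    rewrite -lead_coefE (monicP fm) mul1r => /eqP; rewrite addrC addr_eq0 => /eqP xn.
    rewrite /k hornerD hornerXn horner_poly xn -sumrN -big_split /= -sumrN.
    by apply: eq_bigr => i _; rewrite mulrBl opprB addrC.
  rewrite mulNr rpredN mulr_suml rpred_sum // => i _.
  by have := (gP i).2; rewrite invf_div mulrA.
have [r kr] := closed_field_poly_normal k.
rewrite (monicP km) scale1r in kr.
have sr : size r = n by apply/eqP; rewrite -eqSS -sk kr size_prod_XsubC.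
have rS z : z \in r -> z \in S.
  by move=> zr; apply: (algS k); rewrite ?monic_neq0 // kr root_prod_XsubC.
case: (boolP (has (fun z => (x - z) / e \in O) r)) => [/hasP[z zr hz]|/hasPn far].
  by exists z; rewrite ?rS.
suff : 1 \in max_ideal O by rewrite (negPf max_ideal1).
have k0 : k.[x] != 0.
  rewrite kr horner_prod prodf_seq_neq0; apply/allP => z /far /=; apply: contraNneq.
  by rewrite hornerXsubC => ->; rewrite mul0r rpred0.
have -> : 1 = k.[x] / e ^+ n * (e ^+ n / k.[x]) by field; rewrite k0 expf_neq0.
apply: max_idealMl => //.
have -> : e ^+ n / k.[x] = \prod_(z <- r) (e / (x - z)).
  rewrite big_split /= prodfV kr horner_prod -sr big_const_seq count_predT iter_mulr_1.
  by congr (_ / _); apply: eq_bigr => z _; rewrite hornerXsubC.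
have {}far z : z \in r -> e / (x - z) \in max_ideal O.
  by move=> /far h; rewrite -[e / _]invf_div; apply: invr_notin.
case: (r) sr far => [s0|z s _ far]; first by rewrite -s0 in n0.
rewrite big_cons max_idealMr ?far ?mem_head // big_seq rpred_prod // => y ys.
by apply: max_idealW => //; apply: far; rewrite inE ys orbT.
Qed.

(** * Algebraic approximation inside henselian fields *)

Section Approximation.
Context {L : closedFieldType} {O : subringClosed L} (K : divringClosed L) (p : nat).
Hypothesis val_total : forall x, x \in O \/ x^-1 \in O.
Hypothesis pL : p \in [pchar L].
Hypothesis perfK : {in K, forall a, exists2 b, b \in K & b ^+ p = a}.
Hypothesis cofinal : forall e, e != 0 ->
  exists g, [/\ g \in K, g != 0, g \in max_ideal O & g / e \in O].
Hypothesis archimedean : forall g e, g \in K -> g != 0 -> g \in max_ideal O ->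
  e != 0 -> exists n, g ^+ n / e \in O.

(** Powers of a nonzero element of the maximal ideal are pairwise distinct. They serve as the
    interpolation nodes of [cluster_poly]. *)
Lemma small_elements t n : t != 0 -> exists u : seq L,
  [/\ uniq u, size u = n & {in u, forall c, c \in K /\ c / t \in O}].
Proof.
move=> /cofinal[g [gK g0 gm gt]]; exists [seq g ^+ j.+1 | j <- iota 0 n].
split; last 2 first.
- by rewrite size_map size_iota.
- move=> _ /mapP[j _ ->]; rewrite rpredX //; split=> //.
  by rewrite exprSr -mulrA rpredM // rpredX // max_idealW.
rewrite map_inj_uniq ?iota_uniq //.
have lt i j : (i < j)%N -> g ^+ i.+1 != g ^+ j.+1.
  move=> ij; apply/eqP => E; have /negP[] := @max_ideal1 _ O.
  have <- : g * g ^+ (j - i).-1 = 1.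
    apply: (mulfI (expf_neq0 i.+1 g0)); rewrite mulr1 -exprS -exprD {}E.
    by rewrite prednK ?subn_gt0 // addSn subnKC // ltnW.
  by apply: max_idealMr => //; rewrite rpredX // max_idealW.
move=> i j E; case: (ltngtP i j) => // h; have := lt _ _ h; by rewrite E eqxx.
Qed.

(* Let [h] be the polynomial of the conjugates of [z] that are close to [b], of
   degree [m + 1]. The [m]-th coefficient [A] of [X^(q+m) mod h] plays the role of
   the trace of [z^q y] for an element [y] of trace 1. It satisfies
   [w(A - b^q) >= w c + q (w t)] with [c] independent of [q = p^n], so that the
   loss [w c] becomes negligible after taking the [q]-th root of [A]. *)
Lemma approx_algebraic_hensel b e :
    b \in @topological_closure L O (algebraic_in K) -> e != 0 ->
  exists th, [/\ th \in algebraic_in K, (b - th) / e \in O &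
    forall E : divringClosed L, hensel O E -> {subset K <= E} -> b \in E -> th \in E].
Proof.
move=> bD e0; have [g [gK g0 gm ge]] := cofinal e0.
(* Of the two factors [g^q] of [t^q], one pays for the division by [e^q] and the other absorbs the
   constant [c]. *)
pose t := g ^+ 2; have t0 : t != 0 by rewrite expf_neq0.
have [z zK bz] : exists2 z, z \in algebraic_in K & (b - z) / t \in O.
  by move: bD; rewrite inE => /(_ t t0).
move: (zK); rewrite inE => -[f0 [f00 f0K f0z]].
have [f [fm fK fz _]] : exists f, [/\ f \is monic, f \is a polyOver K, root f z & f^`().[z] != 0].
  by apply: perfect_separable pL perfK _; exists f0.
have [r fr] := closed_field_poly_normal f; rewrite (monicP fm) scale1r in fr.
have rK y : y \in r -> y \in algebraic_in K.
  move=> yr; rewrite inE; exists f; split=> //; first exact: monic_neq0.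
  by rewrite fr root_prod_XsubC.
pose s := [seq c <- r | (c - b) / t \in O].
pose h := \prod_(c <- s) ('X - c%:P).
have zs : z \in s.
  rewrite mem_filter -opprB mulNr rpredN bz /=.
  by rewrite -root_prod_XsubC -fr.
have [u [uu su hu]] := small_elements (size r).+1 t0.
have hE (E : divringClosed L) : hensel O E -> {subset K <= E} -> b \in E -> h \is a polyOver E.
  move=> henE KE bE; rewrite /h big_filter.
  apply: (cluster_poly val_total henE _ t0 bE uu) => [||c cu].
  - by rewrite -fr; exact: polyOverS fK.
  - by rewrite su.
  - by have [cK ct] := hu c cu; split=> //; exact: KE.
have hK : h \is a polyOver (algebraic_in K).
  rewrite /h big_seq rpred_prod // => c cs; rewrite polyOverXsubC rK //.
  by move: cs; rewrite mem_filter => /andP[].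
have hm : h \is monic by exact: monic_prod_XsubC.
pose m := (size s).-1; have sm : size s = m.+1.
  by rewrite prednK // lt0n size_eq0; apply: contraTneq zs => ->.
have sh : size h = m.+2 by rewrite size_prod_XsubC sm.
have hs : {in s, forall c, (c - b) / t \in O} by move=> c; rewrite mem_filter => /andP[].
have [c c0 hc] := cluster_mod_bound ('X^m) m val_total t0 hs; rewrite -/h in hc.
have [n gn] : exists n, g ^+ n / c^-1 \in O by apply: archimedean; rewrite ?invr_eq0.
rewrite invrK in gn.
pose q := (p ^ n)%N.
have qn : (n <= q)%N by exact: ltnW (ltn_expl _ (prime_gt1 (pcharf_prime pL))).
have q0 : (0 < q)%N by rewrite expn_gt0 prime_gt0 // (pcharf_prime pL).
pose A := (('X^q * 'X^m) %% h)`_m.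
have AE (E : divringClosed L) : h \is a polyOver E -> A \in E.
  move=> hE'; apply: (polyOverP (modp_over hm hE' _)).
  by rewrite rpredM ?polyOverXn.
have pn (R : comNzRingType) : p \in [pchar R] -> [pchar R].-nat q.
  by move=> pR; rewrite pnatX pnatE ?(pcharf_prime pR) // pR.
(* In characteristic [p], [(X - b)^q = X^q - b^q]; and [X^m] is already reduced modulo [h], with
   [m]-th coefficient [1]. *)
have Ab : A - b ^+ q = ((('X - b%:P) ^+ q * 'X^m) %% h)`_m.
  rewrite exprDn_pchar ?exprNn_pchar ?pn ?(pchar_poly L) //.
  rewrite -polyC_exp mulrBl mul_polyC modpD modpN modpZl [_ 'X^m h]modp_small.
    by rewrite coefB coefZ coefXn eqxx mulr1.
  by rewrite size_polyXn sh.
have [th thq] : exists th, th ^+ q = A.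
  have : size ('X^q - A%:P) != 1%N by rewrite size_XnsubC // gtn_eqF.
  move=> /closed_rootP[th]; rewrite rootE !hornerE subr_eq0 => /eqP; by exists th.
have thK : th \in algebraic_in K.
  apply: (@algebraic_in_root _ _ ('X^q - A%:P)).
  - by rewrite -size_poly_gt0 size_XnsubC.
  - by rewrite rpredB ?polyOverXn ?polyOverC ?AE.
  - by rewrite rootE !hornerE thq subrr.
exists th; split=> // [|E henE KE bE]; last first.
  move: (thK); rewrite inE => thK'.
  (* The power [th^q = A] is in [E] since [h] is over [E]; perfectness of [K] brings [th] itself
     into [E]. *)
  by apply: (separable_pth_root_iter pL KE perfK thK' (k := n)); rewrite thq AE ?hE.
rewrite -opprB mulNr rpredN; apply: (@expr_in _ O val_total q) => //.
have -> : ((th - b) / e) ^+ q = (A - b ^+ q) / (c * t ^+ q) * (c * g ^+ q) * (g / e) ^+ q.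
  rewrite -thq -exprNn_pchar ?pn // -exprDn_pchar ?pn //.
  rewrite /t -exprM mulnC exprM !expr_div_n.
  by field; rewrite c0 !expf_neq0.
rewrite rpredM ?rpredX // rpredM ?Ab //.
by rewrite -(subnK qn) exprD mulrCA mulrC [c * _]mulrC rpredM ?rpredX // max_idealW.
Qed.

End Approximation.

(** * The valuation ring of a valuation *)

Lemma subfieldP (L : fieldType) (M : set L) :
  subfield M <-> exists E : divringClosed L, M = [set x | x \in E].
Proof.
split=> [hM|[E ->]]; last first.
  split=> [|x y|x y]; rewrite !mem_setE; [exact: rpred1 | exact: rpredB | exact: rpred_div].
pose E : divringClosed L := HB.pack (mem M : {pred L})
  (GRing.isDivringClosed.Build L (mem M) hM).
by exists E; apply/seteqP; split=> x; rewrite /= in_setE.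
Qed.

Lemma polyOver_set (L : fieldType) (E : {pred L}) (f : {poly L}) :
  (f \is a polyOver (mem [set x | x \in E])) = (f \is a polyOver E).
Proof. by apply: eq_all => x; apply/idP/idP => [/set_mem|] // h; exact/mem_set. Qed.

Lemma algebraic_overE (L : fieldType) (K : divringClosed L) x :
  algebraic_over [set y | y \in K] x <-> x \in algebraic_in K.
Proof.
by rewrite inE; split=> -[f [f0 fK fx]]; exists f; rewrite polyOver_set in fK *.
Qed.

Definition val_ring (L : fieldType) (G : porderZmodType) (w : L -> option G) : {pred L} :=
  [pred x | vle (Some 0) (w x)].

Section Valuation.
Context {L : fieldType} {G : porderZmodType} {w : L -> option G}.
Hypotheses (hG : ordered_group G) (hw : valuation w).
Local Notation val_ring := (val_ring w).

Lemma vle_total (a b : option G) : vle a b \/ vle b a.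
Proof.
case: a b => [a|] [b|]; rewrite /=; try by [left|right].
exact/orP/hG.1.
Qed.

Lemma val_Some x : x != 0 -> exists g, w x = Some g.
Proof. by case E: (w x) => [g|]; [exists g | move/(val_eqinf hw): E => ->; rewrite eqxx]. Qed.

Lemma val0 : w 0 = None.
Proof. exact/(val_eqinf hw). Qed.

Lemma val1 : w 1 = Some 0.
Proof.
have [g E] := val_Some (oner_neq0 L).
have := Defs.valM hw 1 1; rewrite mulr1 E => -[] /eqP.
by rewrite -[X in X == _]addr0 (can_eq (addKr g)) => /eqP <-.
Qed.

Lemma le_add0 (a b : G) : 0 <= a -> b <= a + b.
Proof. by move=> /(hG.2 _ _ b); rewrite add0r. Qed.

Lemma valN x : w (- x) = w x.
Proof.
have N10 : -1 != 0 :> L by rewrite oppr_eq0 oner_neq0.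
have [g E] := val_Some N10.
rewrite -mulN1r (Defs.valM hw) E; suff -> : g = 0 by case: (w x) => //= h; rewrite add0r.
have := Defs.valM hw (-1) (-1); rewrite mulrNN mulr1 val1 E => -[] gg.
have := hG.1 0 g => /orP[h|h]; apply/eqP; rewrite eq_le h ?andbT.
  by rewrite [leRHS]gg le_add0.
by have := hG.2 _ _ g h; rewrite -gg add0r.
Qed.

Lemma vle_trans (a b c : option G) : vle a b -> vle b c -> vle a c.
Proof. by case: a b c => [a|] [b|] [c|] //=; exact: le_trans. Qed.

Lemma val_ring_subring : subring_closed val_ring.
Proof.
split=> [|x y|x y]; rewrite !inE.
- by rewrite val1 /=.
- rewrite -[w y]valN => hx hy.
  case: (vle_total (w x) (w (- y))) => h; first exact: vle_trans hx (Defs.valD hw h).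
  by rewrite addrC; exact: vle_trans hy (Defs.valD hw h).
- rewrite (Defs.valM hw); case: (w x) (w y) => [a|] [b|] //= a0 b0.
  exact: le_trans b0 (le_add0 _ a0).
Qed.

Definition val_subring : subringClosed L :=
  HB.pack val_ring (GRing.isSubringClosed.Build L val_ring val_ring_subring).

Lemma valV x g : w x = Some g -> w x^-1 = Some (- g).
Proof.
move=> E; have x0 : x != 0 by apply: contra_eqN E => /eqP->; rewrite val0.
have := Defs.valM hw x x^-1; rewrite divff // val1 E.
by case: (w x^-1) => //= h [] gh; rewrite -(addKr g h) -gh addr0.
Qed.

Lemma le0N (g : G) : (0 <= - g) = (g <= 0).
Proof.
apply/idP/idP => [/(hG.2 _ _ g)|/(hG.2 _ _ (- g))]; first by rewrite add0r addNr.
by rewrite add0r subrr.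
Qed.

Lemma val_ring_total x : x \in val_ring \/ x^-1 \in val_ring.
Proof.
have [->|x0] := eqVneq x 0; first by left; rewrite inE val0.
have [g E] := val_Some x0; rewrite !inE E (valV E) /= le0N.
exact/orP/hG.1.
Qed.

Lemma val_ring_div x y : y != 0 -> (x / y \in val_ring) = vle (w y) (w x).
Proof.
move=> y0; have [g E] := val_Some y0; rewrite inE (Defs.valM hw) (valV E) E.
case: (w x) => [h|] //=; apply/idP/idP => [/(hG.2 _ _ g)|/(hG.2 _ _ (- g))].
  by rewrite add0r subrK.
by rewrite subrr.
Qed.

Lemma max_ideal_val_ring x : (x \in max_ideal val_ring) = vlt (Some 0) (w x).
Proof.
have [->|x0] := eqVneq x 0; first by rewrite val0 inE eqxx.
have [g E] := val_Some x0; rewrite inE (negPf x0) /= inE (valV E) E /= le0N /vlt /=.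
have -> : (Some 0 != Some g) = (0 != g) by [].
apply/idP/andP => [g0|[g0 gn]]; last first.
  by apply: contra gn => h; rewrite eq_le g0.
have : 0 <= g by have /orP[//|h] := hG.1 0 g; rewrite h in g0.
by move=> h; split=> //; apply: contra g0 => /eqP<-.
Qed.

Lemma henselian_hensel (E : divringClosed L) :
  henselian w [set x | x \in E] -> hensel val_ring E.
Proof.
move=> [_ H] f a fm fE fO aE aO fa f'a.
have [] := H f a fm.
- by apply/allP => c cf; rewrite inE; split; [exact: (allP fE) | exact: (allP fO)].
- by split; [exact: aE | exact: aO].
- split; last by rewrite -max_ideal_val_ring.
  by rewrite /= rpred_horner.
- by move=> [_]; rewrite -max_ideal_val_ring => h; rewrite h in f'a.
move=> b [[bM _] fb [_ ba]]; exists b => //.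
by rewrite max_ideal_val_ring.
Qed.

End Valuation.

(** * Henselian generators *)

(* Krasner's constant: [b] closer to [a] than the radius [e] is closer to [a] than
   to any element of [r]. *)
Lemma krasner_radius (L : fieldType) (O : subringClosed L) (pi a : L) (r : seq L) :
    (forall x, x \in O \/ x^-1 \in O) -> pi != 0 -> pi \in max_ideal O -> a \notin r ->
  exists2 e, e != 0 & forall b, (b - a) / e \in O ->
    {in r, forall z, z != b /\ (b - a) / (b - z) \in max_ideal O}.
Proof.
move=> val_total pi0 pim ar.
(* The value of [c^-1] is at least that of every [a - z]; the factor [pi] makes the inequality for
   [e = pi / c] strict. *)
have [c [c0 _ hc]] := common_scale [seq (a - z)^-1 | z <- r] val_total.
exists (pi / c); first by rewrite mulf_neq0 ?invr_eq0.
move=> b hb z zr; have az : a - z != 0.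
  by rewrite subr_eq0; apply: contraNneq ar => ->.
have small : (b - a) / (a - z) \in max_ideal O.
  have -> : (b - a) / (a - z) = (b - a) / (pi / c) * pi * ((a - z)^-1 / c).
    by field; rewrite c0 pi0 az.
  by rewrite max_idealMr ?max_idealMl // hc //; apply/mapP; exists z.
have bz : (b - z) / (a - z) = 1 + (b - a) / (a - z) by field.
have bzu : (b - z) / (a - z) \notin max_ideal O.
  by rewrite (max_ideal_congr val_total (y := 1)) ?max_ideal1 // bz addrAC subrr add0r.
have bz0 : b - z != 0 by apply: contraNneq bzu => ->; rewrite mul0r max_ideal0.
split; first by rewrite eq_sym -subr_eq0.
have -> : (b - a) / (b - z) = (b - a) / (a - z) * ((b - z) / (a - z))^-1.
  by field; rewrite az bz0.
rewrite max_idealMr // unit_inv // bz rpredD ?rpred1 //; exact: max_idealW.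
Qed.

Section Main.
Context {L : closedFieldType} {O : subringClosed L} (K F : divringClosed L) (p : nat) (X : L).
Hypothesis val_total : forall x, x \in O \/ x^-1 \in O.
Hypothesis pL : p \in [pchar L].
Hypothesis perfK : {in K, forall a, exists2 b, b \in K & b ^+ p = a}.
Hypothesis KF : {subset K <= F}.
Hypothesis cofinal : forall e, e != 0 ->
  exists g, [/\ g \in K, g != 0, g \in max_ideal O & g / e \in O].
Hypothesis archimedean : forall g e, g \in K -> g != 0 -> g \in max_ideal O ->
  e != 0 -> exists n, g ^+ n / e \in O.
Hypotheses (XF : X \in F) (XK : X \notin algebraic_in K).

(** Choose [th] within the Krasner radius of [b] with respect to the other roots of [f]. Newton's
    lemma centred at [th] then recovers [b] over every henselian field containing [th] and the
    coefficients of [f]. *)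
Lemma descend_generator b (S : {pred L}) (f : {poly L}) :
    b \in F -> b \in @topological_closure L O (algebraic_in K) ->
    f \is monic -> f \is a polyOver S -> root f b -> separable_poly f ->
  exists th, [/\ th \in algebraic_in K,
    forall E : divringClosed L, hensel O E -> {subset F <= E} -> th \in E &
    forall E : divringClosed L, hensel O E -> {subset S <= E} -> th \in E -> b \in E].
Proof.
move=> bF bD fm fS fb sepf; have [pi [_ pi0 pim _]] := cofinal (oner_neq0 L).
have [r fr] := closed_field_poly_normal f; rewrite (monicP fm) scale1r in fr.
have br : b \in r by rewrite -root_prod_XsubC -fr.
(* Separability makes [b] a simple root, hence different from all the remaining ones. *)
have ur : uniq r by rewrite -separable_prod_XsubC -fr.
have brem : b \notin rem b r by rewrite mem_rem_uniqF.
have [e e0 he] := krasner_radius val_total pi0 pim brem.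
have [th [thK thb thE]] := approx_algebraic_hensel val_total pL perfK cofinal archimedean bD e0.
exists th; split=> // E henE SE.
  by apply: thE => // [x /KF /SE //|]; exact: SE.
move=> thE'; apply: (newton val_total henE (b := th) (r := rem b r)) => //.
  by move: fr; rewrite (big_rem b) //= => <-; exact: polyOverS fS.
by apply: he; rewrite -opprB mulNr rpredN.
Qed.

(* [Z = th + c Y] with [c Y] inside Krasner's radius of [th] over [K]. *)
Lemma combine_generators th Y :
    th \in algebraic_in K -> Y \notin algebraic_in K ->
  exists Z, [/\ Z \notin algebraic_in K,
    forall E : divringClosed L, {subset K <= E} -> th \in E -> Y \in E -> Z \in E &
    forall E : divringClosed L, hensel O E -> {subset K <= E} -> Z \in E ->
      th \in E /\ Y \in E].
Proof.
move=> thK YK; have [pi [_ pi0 pim _]] := cofinal (oner_neq0 L).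
have Y0 : Y != 0 by apply: contraNneq YK => ->; exact: rpred0.
move: (thK); rewrite inE => thK'.
have [f [fm fK fth f'th]] := perfect_separable pL perfK thK'.
have [q fq] := factor_theorem _ _ fth.
have qm : q \is monic by move: fm; rewrite fq monicMr // monicXsubC.
have [r qr] := closed_field_poly_normal q; rewrite (monicP qm) scale1r in qr.
have thr : th \notin r.
  rewrite -root_prod_XsubC -qr; apply: contra f'th => /rootP qth.
  by rewrite fq derivM hornerD !hornerM qth hornerXsubC subrr mulr0 mul0r addr0.
have [e e0 he] := krasner_radius val_total pi0 pim thr.
have [c [cK c0 _ hc]] := cofinal (mulf_neq0 e0 (invr_neq0 Y0)).
have cE (E : divringClosed L) : {subset K <= E} -> th + c * Y \in E -> th \in E -> Y \in E.
  move=> KE ZE thE; have -> : Y = (th + c * Y - th) / c by field.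
  by apply: rpred_div; [exact: rpredB | exact: KE].
exists (th + c * Y); split.
- by apply: contra YK => ZK; apply: (cE (algebraic_in K)) => //; exact: algebraic_in_sub.
- by move=> E KE thE YE; apply: rpredD => //; apply: rpredM => //; exact: KE.
move=> E henE KE ZE; suff thE : th \in E by split=> //; exact: cE.
apply: (newton val_total henE (b := th + c * Y) (r := r)) => //.
  by rewrite -qr mulrC -fq; exact: polyOverS fK.
apply: he; rewrite addrC addKr.
by move: hc; rewrite invf_div mulrA.
Qed.

(** Membership in every henselian [E] above [F], or above [K] and [Y], expresses membership in [F^h]
    or [K(Y)^h]. The set [S] holds the coefficients of the polynomials of the generators and will be
    [K(X)]. *)
Lemma henselian_generator (S : {pred L}) (s : seq L) :
    (forall E : divringClosed L, {subset K <= E} -> X \in E -> {subset S <= E}) ->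
    {in s, forall b, [/\ b \in F, b \in @topological_closure L O (algebraic_in K) &
       exists f, [/\ f \is monic, f \is a polyOver S, root f b & separable_poly f]]} ->
  exists Y, [/\ Y \notin algebraic_in K,
    forall E : divringClosed L, hensel O E -> {subset F <= E} -> Y \in E &
    forall E : divringClosed L, hensel O E -> {subset K <= E} -> Y \in E ->
      X \in E /\ {subset s <= E}].
Proof.
move=> SX; elim: s => [|b s IH] hs.
  by exists X; split=> // E _ FE; exact: FE.
have [|Y [YK YF YE]] := IH.
  by move=> x xs; apply: hs; rewrite inE xs orbT.
have [bF bD [f [fm fS fb sepf]]] := hs b (mem_head _ _).
have [th [thK thF thb]] := descend_generator bF bD fm fS fb sepf.
have [Z [ZK ZF ZE]] := combine_generators thK YK.
exists Z; split=> // [E henE FE|E henE KE ZinE].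
  apply: ZF; [by move=> x /KF /FE | exact: thF | exact: YF].
have [thE YinE] := ZE E henE KE ZinE; have [XE sE] := YE E henE KE YinE.
split=> // x; rewrite inE => /orP[/eqP->|/sE //].
by apply: thb => //; exact: SX.
Qed.

End Main.

(** For [e] in [O], take a polynomial over [F] with root [e] and strip factors [X] until its
    constant term [a = - q(e) e] is nonzero. If [d] scales the coefficients of [q] into [O], then
    [a / d] is in [e O]. *)
Lemma algebraic_bounded (L : fieldType) (O : subringClosed L) (F : divringClosed L) e :
    (forall x, x \in O \/ x^-1 \in O) -> e != 0 -> e \in algebraic_in F ->
  exists c, [/\ c \in F, c != 0 & c / e \in O].
Proof.
move=> val_total e0; rewrite inE => -[f [f0 fF fe]].
have [eV|eV] := boolP (e^-1 \in O).
  by exists 1; rewrite rpred1 oner_eq0 mul1r.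
have eO : e \in O by case: (val_total e) => // h; rewrite h in eV.
elim/poly_ind: f f0 fF fe => [|q a IH]; first by rewrite eqxx.
have [-> q0|a0 _ fF fe] := eqVneq a 0.
  rewrite addr0 in q0 *; move=> qF; rewrite rootM rootX (negPf e0) orbF => qe.
  apply: IH => //; first by apply: contraNneq q0 => ->; rewrite mul0r.
  apply/polyOverP => i; have := polyOverP qF i.+1; by rewrite coefMX.
have aF : a \in F by have := polyOverP fF 0; rewrite coefD coefMX coefC add0r.
have qF i : q`_i \in F.
  by have := polyOverP fF i.+1; rewrite coefD coefMX coefC addr0.
have [d [d0 dq hd]] := common_scale (polyseq q) val_total.
have dF : d \in F.
  by move: dq; rewrite inE => /orP[/eqP->|/(nthP 0)[i _ <-]]; rewrite ?rpred1.
exists (a / d); split; first exact: rpred_div.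
  by rewrite mulf_neq0 ?invr_eq0.
have -> : a = - (q.[e] * e).
  by apply/eqP; have := rootP fe; rewrite !hornerE => /eqP; rewrite addrC addr_eq0.
have -> : - (q.[e] * e) / d / e = - (q.[e] / d) by field; rewrite e0 d0.
rewrite rpredN horner_coef mulr_suml rpred_sum // => i _.
by rewrite mulrAC rpredM ?rpredX // hd // mem_nth.
Qed.

(** * Rank one: cofinality and the archimedean property *)

Section RankOne.
Context {L : fieldType} {G : porderZmodType} {w : L -> option G} (K F : divringClosed L).
Hypotheses (hG : ordered_group G) (hw : valuation w).
Hypothesis hrank : rank_one (value_group w [set x | x \in K]).
Hypothesis hKF : value_group w [set x | x \in F] = value_group w [set x | x \in K].
Hypothesis hL : forall x : L, x \in algebraic_in F.

Local Notation O := (val_subring hG hw).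
Let val_total : forall x, x \in O \/ x^-1 \in O := val_ring_total hG hw.
Let O_div x y : y != 0 -> (x / y \in O) = vle (w y) (w x) := val_ring_div hG hw x (y := y).

Lemma rank_one_uniformizer :
  exists x, [/\ x \in K, x != 0 & x \in max_ideal O].
Proof.
have [x [xK x0 wx]] : exists x, [/\ x \in K, x != 0 & w x != Some 0].
  apply: contrapT => H; apply: hrank.1; apply/seteqP; split=> [g [x xK wx]|_ ->].
    apply: contrapT => g0; apply: H; exists x; split=> //.
      by apply: contra_eqN wx => /eqP->; rewrite (val0 hw).
    by rewrite wx; apply/eqP => -[].
  by exists 1; [exact: rpred1 | rewrite (val1 hw)].
have wlt y : vlt (Some 0) (w y) -> y \in max_ideal O by rewrite (max_ideal_val_ring hG hw).
case: (val_total x) => [xO|xO].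
  by exists x; split=> //; apply: wlt; apply/andP; rewrite eq_sym.
exists x^-1; rewrite rpredV invr_eq0; split=> //; apply: wlt; apply/andP; split=> //.
have [g E] := val_Some hw x0; rewrite (valV hw E) eq_sym; apply: contra wx.
by rewrite E => /eqP[] /eqP; rewrite oppr_eq0 => /eqP->.
Qed.

(** Algebraicity of [L] over [F] bounds [e] by an element of [F], and the equality of value groups
    replaces it by one of [K]. *)
Lemma rank_one_cofinal e : e != 0 ->
  exists g, [/\ g \in K, g != 0, g \in max_ideal O & g / e \in O].
Proof.
move=> e0; have [pi [piK pi0 pim]] := rank_one_uniformizer.
have [c [cF c0 ce]] := algebraic_bounded val_total e0 (hL e).
have [g wc] := val_Some hw c0.
have [d dK wd] : value_group w [set x | x \in K] g by rewrite -hKF; exists c.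
have d0 : d != 0 by apply: contra_eqN wd => /eqP->; rewrite (val0 hw).
have de : d / e \in O.
  have -> : d / e = d / c * (c / e) by field; rewrite c0 e0.
  by rewrite rpredM // O_div // wc wd /=.
(* If [d] is outside the maximal ideal, then [d^-1] is in [O], so [e^-1] is in [O] too and [pi] will
   do. *)
have [dm|dm] := boolP (d \in max_ideal O); first by exists d.
exists pi; split=> //; have -> : pi / e = pi * d^-1 * (d / e) by field; rewrite e0 d0.
rewrite rpredM // rpredM //; first exact: max_idealW.
by move: dm; rewrite inE negb_or negbK => /andP[].
Qed.

(* The elements bounded by multiples of the value of [g] form a nonzero convex
   subgroup. *)
Lemma rank_one_archimedean g e : g \in K -> g != 0 -> g \in max_ideal O -> e != 0 ->
  exists n, g ^+ n / e \in O.
Proof.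
move=> gK g0 gm e0; have [c [cK c0 _ ce]] := rank_one_cofinal e0.
suff [n hn] : exists n, g ^+ n / c \in O.
  exists n; have -> : g ^+ n / e = g ^+ n / c * (c / e) by field; rewrite c0 e0.
  exact: rpredM.
have gO : g \in O by apply: max_idealW.
pose H : set G := [set h | exists x, [/\ x \in K, w x = Some h &
  exists n, g ^+ n * x \in O /\ g ^+ n / x \in O]].
have wN0 x h : w x = Some h -> x != 0.
  by move=> E; apply: contra_eqN E => /eqP->; rewrite (val0 hw).
have [] := hrank.2 H.
- split.
  + by move=> h [x [xK wx _]]; exists x.
  + split=> [|h k]; rewrite !inE.
      exists 1; rewrite rpred1 (val1 hw); split=> //; exists 0%N.
      by rewrite expr0 invr1 mulr1 rpred1.
    move=> [x [xK wx [n [n1 n2]]]] [y [yK wy [m [m1 m2]]]].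
    exists (x / y); split; first exact: rpred_div.
      by rewrite (Defs.valM hw) wx (valV hw wy).
    exists (n + m)%N; rewrite exprD; split.
      by rewrite mulrACA rpredM.
    have -> : g ^+ n * g ^+ m / (x / y) = g ^+ n / x * (g ^+ m * y).
      by field; rewrite (wN0 _ _ wx) (wN0 _ _ wy).
    exact: rpredM.
  + move=> h k [y yK wy] [x [xK wx [n [n1 n2]]]] h0 hk.
    exists y; split=> //; exists n.
    have yO : y \in O by rewrite inE /= wy.
    split; first by rewrite rpredM // rpredX.
    have -> : g ^+ n / y = g ^+ n / x * (x / y) by field; rewrite (wN0 _ _ wx) (wN0 _ _ wy).
    by rewrite rpredM // O_div ?wx ?wy //; exact: wN0 wy.
(* The positive value of [g] lies in [H], which excludes [H = 0]; so [H] also contains the value of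
   [c]. *)
- have [h wg] := val_Some hw g0 => H0.
  have : H h.
    exists g; split=> //; exists 1%N.
    by rewrite expr1 rpredM // divff // rpred1.
  rewrite H0 => h0; move: gm; rewrite (max_ideal_val_ring hG hw) wg h0.
  by rewrite /vlt eqxx andbF.
move=> HK; have [h wc] := val_Some hw c0.
have : H h by rewrite HK; exists c.
move=> [x [xK wx [n [_ n2]]]]; exists n; have x0 := wN0 _ _ wx.
have -> : g ^+ n / c = g ^+ n / x * (x / c) by field; rewrite x0 c0.
by rewrite rpredM // O_div // wc wx /=.
Qed.

End RankOne.


(** * Limits of elements algebraic over [K] *)

Lemma type_II_closure (L : fieldType) (G : porderZmodType) (w : L -> option G)
    (hG : ordered_group G) (hw : valuation w) (K : divringClosed L) X :
    (forall e, e != 0 -> exists g, [/\ g \in K, g != 0, g \in max_ideal (val_ring w) &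
       g / e \in val_ring w]) ->
    type_II w [set x | x \in K] X ->
  X \in @topological_closure L (val_subring hG hw) (algebraic_in K).
Proof.
move=> cof [d [I [z [_ zK _ [_ zX] zg]]]]; rewrite inE => e e0.
have [g [gK g0 _ ge]] := cof e e0; have [c wg] := val_Some hw g0.
(* Cofinality yields successive indices with [w (z i - z j)] at least [w g], and this value is also
   that of [X - z i]. *)
have [|i [j [ij h]]] := zg c.
  by exists g => //; apply/algebraic_overE/algebraic_in_sub.
exists (z i); first exact/algebraic_overE/zK.
have -> : (X - z i) / e = (X - z i) / g * (g / e) by field; rewrite g0 e0.
apply: rpredM => //; rewrite [_ \in _](val_ring_div hG hw) // wg.
by rewrite (zX i j ij).
Qed.

(** The closure is a field containing [K] and [X], hence the coefficients of the minimal polynomial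
    of [y]; by [closure_root] it contains the root [y] as well. *)
Lemma separable_in_closure (L : closedFieldType) (O : subringClosed L) (K : divringClosed L)
    (pi X : L) y :
    (forall x, x \in O \/ x^-1 \in O) -> pi != 0 -> pi \in max_ideal O ->
    X \in @topological_closure L O (algebraic_in K) ->
    separable_over (adjoin [set x | x \in K] [set X]) y ->
  y \in @topological_closure L O (algebraic_in K).
Proof.
move=> val_total pi0 pim XD [q [qm qK qy _] _].
have sD : subfield [set x | x \in @topological_closure L O (algebraic_in K)].
  have [D1 DB DM] := closure_divring (algebraic_in K) val_total pi0 pim.
  split; rewrite ?inE //.
    by move=> x t; rewrite !mem_setE; exact: DB.
  by move=> x t; rewrite !mem_setE; exact: DM.
apply: (closure_root val_total _ qm _ qy); first exact: algebraic_in_root.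
apply: polyOverS qK => x /set_mem xA.
suff /(_ x xA) : adjoin [set x | x \in K] [set X] `<=`
  [set x | x \in @topological_closure L O (algebraic_in K)] by [].
apply: smallest_sub => // t [tK|->] //=.
by apply: closure_sub; exact: algebraic_in_sub.
Qed.

Theorem proposition8p7 (L : closedFieldType) (G : porderZmodType)
  (hG : ordered_group G) (w : L -> option G) (hw : valuation w)
  (K F : set L) (hK : subfield K) (hF : subfield F)
  (hL : forall x : L, algebraic_over F x)
  (hKperf : perfect K) (hrank : rank_one (value_group w K))
  (p : nat) (hp : p \in [pchar L]) (hodd : odd p)
  (hFK : function_field1 K F) (himm : immediate w K F)
  (hKr : K = ramification_field w K)
  (X : L) (hX : (F `\` K) X) (hsep : separating_element K F X)
  (hII : type_II w K X) :
  henselian_rational w K F.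
Proof.
clear hodd hKr.
have /subfieldP[K' EK] := hK; have /subfieldP[F' EF] := hF; subst K F.
have [KF wF _] := himm; have [_ [s Fs] _] := hFK.
have [XF XK _ Xsep] := hsep.
have hL' x : x \in algebraic_in F' by apply/algebraic_overE.
pose O := val_subring hG hw.
have val_total : forall x, x \in O \/ x^-1 \in O := val_ring_total hG hw.
have cof := rank_one_cofinal hG hw hrank wF hL' : forall e, e != 0 -> exists g,
  [/\ g \in K', g != 0, g \in max_ideal O & g / e \in O].
have arch := rank_one_archimedean (hG := hG) (hw := hw) hrank wF hL'.
have [pi [_ pi0 pim _]] := cof 1 (oner_neq0 L).
have XD := type_II_closure hG hw cof hII.
have perfK : {in K', forall a, exists2 b, b \in K' & b ^+ p = a}.
  by move=> a aK; have [b bK ba] := hKperf p hp a aK; exists b.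
have XK' : X \notin algebraic_in K' by apply/negP => /algebraic_overE.
pose S : {pred L} := mem (adjoin [set x | x \in K'] [set X]).
have [|b bs|Y [YK YF YE]] := @henselian_generator L O K' F' p X val_total hp perfK
  KF cof arch XF XK' S s.
- move=> E KE XE x /set_mem; have /(_ x) : adjoin [set x | x \in K'] [set X] `<=` [set x | x \in E].
    apply: smallest_sub => [|t [tK|->]] //; last exact: KE.
    by apply/subfieldP; exists E.
  by [].
- have bF : [set x | x \in F'] b by rewrite Fs; apply: sub_gen_smallest; right.
  have bsep := Xsep b bF; split; first exact: bF.
    exact: separable_in_closure val_total pi0 pim XD bsep.
  by case: bsep => q [qm qS qb _] qsep; exists q.
have YF' M : henselian w M -> [set x | x \in F'] `<=` M -> M Y.
  move=> henM; have /subfieldP[E EM] := henM.1; subst M => FE.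
  by apply: YF => //; exact: henselian_hensel henM.
exists Y; split.
- by move=> M [henM FM]; exact: YF'.
- by move/algebraic_overE; exact/negP.
(* Henselizations are intersections of henselian fields, so it suffices that a henselian [M]
   contains [F] exactly when it contains [K(Y)]. *)
apply/seteqP; split=> x xh M [henM KM]; last first.
  apply: xh; split=> //; apply: smallest_sub; first exact: henM.1.
  by move=> y [yK|->]; [exact/KM/KF | exact: YF'].
apply: xh; split=> //; have YM : M Y by apply: KM; apply: sub_gen_smallest; right.
have K'M : [set x | x \in K'] `<=` M by move=> y yK; apply: KM; apply: sub_gen_smallest; left.
have /subfieldP[E EM] := henM.1; subst M.
have [_ sE] := YE E (henselian_hensel hG hw henM) K'M YM.
rewrite Fs; apply: smallest_sub; first exact: henM.1.
by move=> y [yK|ys]; [exact: K'M | exact: sE].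
Qed.
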